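(* In the setting of the forward linear-quadratic problem (FLQ) described in the context, assume: (i) $M$ is positive definite and $G(\omega)$ is nonnegative definite for every $\omega\in\Omega$; (ii) $Q_k(\omega)$ is nonnegative definite for every $(\omega,k)\in\Omega\times\mathbb T$; (iii) there is a constant $\delta>0$ such that $R_k(\omega)-\delta I_m\ge0$ for every $(\omega,k)\in\Omega\times\mathbb T$, where $I_m$ is the unit matrix. Then the Hamiltonian system $$ \begin{cases} \bar x_{k+1}=A_k\bar x_k+B_k\bar u_k+b_k+\{C_k\bar x_k+D_k\bar u_k+\sigma_k\}\,w_k, & k\in\mathbb T,\\ \bar y_k=A_k^\top\bar y'_{k+1}+C_k^\top\bar z'_{k+1}+Q_k\bar x_k, & k\in\mathbb T,\\ \bar x_0=-M^{-1}\bar y_0,\qquad \bar y_N=G\bar x_N,\\ 0=B_k^\top\bar y'_{k+1}+D_k^\top\bar z'_{k+1}+R_k\bar u_k, & k\in\mathbb T, \end{cases} $$ where $\bar y'_{k+1}=\mathbb E[\bar y_{k+1}\mid\mathcal F_{k-1}]$ and $\bar z'_{k+1}=\mathbb E[\bar y_{k+1}w_k\mid\mathcal F_{k-1}]$, admits a unique solution $(\bar x(\cdot),\bar y(\cdot))\in N^2(\overline{\mathbb T};\mathbb R^{2n})$. Moreover, $\bar\xi=-M^{-1}\bar y_0$ is the unique optimal initial state and $$ \bar u_k=-R_k^{-1}\big(B_k^\top\bar y'_{k+1}+D_k^\top\bar z'_{k+1}\big),\qquad k\in\mathbb T, $$ is the unique optimal control of Problem (FLQ).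
   Context: **Probabilistic setting.** $N$ is a fixed positive integer, $\mathbb T=\{0,\dots,N-1\}$, $\overline{\mathbb T}=\{0,\dots,N\}$. On a complete probability space $(\Omega,\mathcal F,\mathbb P)$, $\{w_k\}_{k\in\mathbb T}$ is a real-valued martingale difference sequence with respect to the filtration $\mathcal F_k=\sigma(w_0,\dots,w_k)$, $k=0,\dots,N-1$, with $\mathcal F_{-1}=\{\emptyset,\Omega\}$ trivial: $\mathbb E[w_k\mid\mathcal F_{k-1}]=0$ and $\mathbb E[w_k^2\mid\mathcal F_{k-1}]=1$ for all $k\in\mathbb T$. **Spaces.** $\mathbb S^n$ is the set of symmetric $n\times n$ real matrices. For $\mathbb K\in\{\mathbb T,\overline{\mathbb T}\}$, $L^2_{\mathbb F}(\mathbb K;\mathbb H)$ (resp. $L^\infty_{\mathbb F}(\mathbb K;\mathbb H)$) is the set of $\mathbb H$-valued processes $(h_k)_{k\in\mathbb K}$ with $h_k$ being $\mathcal F_{k-1}$-measurable and $\mathbb E\sum_{k\in\mathbb K}\|h_k\|^2<\infty$ (resp. essentially bounded). $L^\infty_{\mathcal F_{N-1}}(\Omega;\mathbb H)$ is the set of essentially bounded $\mathcal F_{N-1}$-measurable $\mathbb H$-valued random variables. $N^2(\overline{\mathbb T};\mathbb R^{2n})=L^2_{\mathbb F}(\overline{\mathbb T};\mathbb R^n)\times L^2_{\mathbb F}(\overline{\mathbb T};\mathbb R^n)$. The set of admissible controls is $\mathbb U=\{u=(u_0,\dots,u_{N-1}):u_k\in\mathbb R^m\text{ is }\mathcal F_{k-1}\text{-measurable},\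 \mathbb E\sum_{k=0}^{N-1}|u_k|^2<\infty\}$. **Problem (FLQ).** For $\xi\in\mathbb R^n$ and $u(\cdot)\in\mathbb U$ let $x(\cdot)\in L^2_{\mathbb F}(\overline{\mathbb T};\mathbb R^n)$ be the unique solution of $$x_{k+1}=A_kx_k+B_ku_k+b_k+(C_kx_k+D_ku_k+\sigma_k)w_k,\quad k\in\mathbb T,\qquad x_0=\xi,$$ where $b(\cdot),\sigma(\cdot)\in L^2_{\mathbb F}(\mathbb T;\mathbb R^n)$, $A(\cdot),C(\cdot)\in L^\infty_{\mathbb F}(\mathbb T;\mathbb R^{n\times n})$, $B(\cdot),D(\cdot)\in L^\infty_{\mathbb F}(\mathbb T;\mathbb R^{n\times m})$. The criterion is $$J(0;\xi,u(\cdot))=\tfrac12\mathbb E\Big\{\langle Mx_0,x_0\rangle+\langle Gx_N,x_N\rangle+\sum_{k=0}^{N-1}\big[\langle Q_kx_k,x_k\rangle+\langle R_ku_k,u_k\rangle\big]\Big\},$$ with $M\in\mathbb S^n$, $G\in L^\infty_{\mathcal F_{N-1}}(\Omega;\mathbb S^n)$, $Q(\cdot)\in L^\infty_{\mathbb F}(\mathbb T;\mathbb S^n)$, $R(\cdot)\in L^\infty_{\mathbb F}(\mathbb T;\mathbb S^m)$. Problem (FLQ) is to find $(\bar\xi,\bar u(\cdot))\in\mathbb R^n\times\mathbb U$ with $J(0;\bar\xi,\bar u(\cdot))=\inf_{(\xi,u(\cdot))\in\mathbb R^n\times\mathbb U}J(0;\xi,u(\cdot))$; such $\bar\xi$ is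 called an optimal initial state and $\bar u(\cdot)$ an optimal control. *)

(* Defs.v *)
From HB Require Import structures.
From mathcomp Require Import all_boot all_order all_algebra.
From mathcomp Require Import all_classical all_reals all_analysis.

Set Implicit Arguments.
Unset Strict Implicit.
Unset Printing Implicit Defensive.

Import Order.TTheory GRing.Theory Num.Theory.
Import numFieldNormedType.Exports.

Local Open Scope classical_set_scope.
Local Open Scope ring_scope.

Definition dot (R : realType) (n : nat) (x y : 'cV[R]_n) : R :=
  \sum_(i < n) x i 0 * y i 0.

(* The Euclidean norm of a column vector, the Frobenius norm of a matrix. *)
Definition fnorm (R : realType) (p q : nat) (A : 'M[R]_(p, q)) : R :=
  Num.sqrt (\sum_(i < p) \sum_(j < q) A i j ^+ 2).

Definition symmetric_mx (R : realType) (n : nat) (A : 'M[R]_n) : Prop :=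
  A^T = A.

Definition posdef (R : realType) (n : nat) (A : 'M[R]_n) : Prop :=
  forall x : 'cV[R]_n, x != 0 -> 0 < dot (A *m x) x.

Definition nonnegdef (R : realType) (n : nat) (A : 'M[R]_n) : Prop :=
  forall x : 'cV[R]_n, 0 <= dot (A *m x) x.

(* Below, F is a sub-sigma-algebra, represented by its collection of sets. *)

Definition measurable_wrt (T : Type) (R : realType) (F : set (set T))
    (X : T -> R) : Prop :=
  preimage_set_system setT X measurable `<=` F.

Definition mx_measurable_wrt (T : Type) (R : realType) (F : set (set T))
    (p q : nat) (X : T -> 'M[R]_(p, q)) : Prop :=
  forall i j, measurable_wrt F (fun omega => X omega i j).

Definition is_cond_exp (d : measure_display) (T : measurableType d)
    (R : realType) (P : probability T R) (F : set (set T)) (X Y : T -> R) :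
    Prop :=
  [/\ P.-integrable setT (EFin \o X),
      P.-integrable setT (EFin \o Y),
      measurable_wrt F Y
    & forall A, F A ->
        (\int[P]_(omega in A) (X omega)%:E =
         \int[P]_(omega in A) (Y omega)%:E)%E].

(* A chosen version; it is 0 when X has no conditional expectation given F,
   for instance when X is not integrable. *)
Definition cond_exp (d : measure_display) (T : measurableType d)
    (R : realType) (P : probability T R) (F : set (set T)) (X : T -> R) :
    T -> R :=
  xget (cst 0) [set Y | is_cond_exp P F X Y].

Definition mx_cond_exp (d : measure_display) (T : measurableType d)
    (R : realType) (P : probability T R) (F : set (set T)) (p q : nat)
    (X : T -> 'M[R]_(p, q)) (omega : T) : 'M[R]_(p, q) :=
  \matrix_(i, j) cond_exp P F (fun omega' => X omega' i j) omega.

(* Time-indexed families are functions of k : nat; only the values at the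
   times k < N (or k <= N for the state and the adjoint) are relevant. *)

(* past w k is the sigma-algebra F_(k-1) generated by w_0, ..., w_(k-1); it is
   not completed, and past w 0 is trivial. *)
Definition past (d : measure_display) (T : measurableType d) (R : realType)
    (P : probability T R) (w : nat -> {RV P >-> R}) (k : nat) : set (set T) :=
  g_sigma_preimage (fun i : 'I_k => (w i : T -> R)).

Definition mart_diff (d : measure_display) (T : measurableType d)
    (R : realType) (P : probability T R) (N : nat) (w : nat -> {RV P >-> R}) :
    Prop :=
  forall k, (k < N)%N ->
    is_cond_exp P (past w k) (w k) (cst 0) /\
    is_cond_exp P (past w k) (fun omega => w k omega ^+ 2) (cst 1).

Definition adapted (d : measure_display) (T : measurableType d) (R : realType)
    (P : probability T R) (w : nat -> {RV P >-> R}) (K p q : nat)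
    (h : nat -> T -> 'M[R]_(p, q)) : Prop :=
  forall k, (k < K)%N -> mx_measurable_wrt (past w k) (h k).

(* L^2_F over the times 0, ..., K - 1. *)
Definition L2F (d : measure_display) (T : measurableType d) (R : realType)
    (P : probability T R) (w : nat -> {RV P >-> R}) (K p q : nat) :
    set (nat -> T -> 'M[R]_(p, q)) :=
  [set h | adapted w K h /\
    ('E_P[(fun omega => \sum_(k < K) fnorm (h k omega) ^+ 2)%R] < +oo)%E].
Arguments L2F {d T R P} w K {p q}.

Definition ess_bounded (d : measure_display) (T : measurableType d)
    (R : realType) (P : probability T R) (p q : nat)
    (X : T -> 'M[R]_(p, q)) : Prop :=
  exists c : R, {ae P, forall omega, fnorm (X omega) <= c}.

(* L^oo_F over the times 0, ..., K - 1. *)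
Definition LooF (d : measure_display) (T : measurableType d) (R : realType)
    (P : probability T R) (w : nat -> {RV P >-> R}) (K p q : nat) :
    set (nat -> T -> 'M[R]_(p, q)) :=
  [set h | adapted w K h /\ forall k, (k < K)%N -> ess_bounded P (h k)].
Arguments LooF {d T R P} w K {p q}.

Record flq_data (T : Type) (R : realType) (n m : nat) := FLQData {
  cA : nat -> T -> 'M[R]_n;
  cB : nat -> T -> 'M[R]_(n, m);
  cb : nat -> T -> 'cV[R]_n;
  cC : nat -> T -> 'M[R]_n;
  cD : nat -> T -> 'M[R]_(n, m);
  csigma : nat -> T -> 'cV[R]_n;
  cM : 'M[R]_n;
  cG : T -> 'M[R]_n;
  cQ : nat -> T -> 'M[R]_n;
  cR : nat -> T -> 'M[R]_m }.

Definition flq_setting (d : measure_display) (T : measurableType d)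
    (R : realType) (P : probability T R) (N : nat) (w : nat -> {RV P >-> R})
    (n m : nat) (E : flq_data T R n m) : Prop :=
  [/\ [/\ L2F w N (cb E) & L2F w N (csigma E)],
      [/\ LooF w N (cA E), LooF w N (cC E), LooF w N (cB E)
        & LooF w N (cD E)],
      symmetric_mx (cM E),
      [/\ mx_measurable_wrt (past w N) (cG E), ess_bounded P (cG E)
        & forall omega, symmetric_mx (cG E omega)]
    & [/\ LooF w N (cQ E), LooF w N (cR E),
          forall k omega, (k < N)%N -> symmetric_mx (cQ E k omega)
        & forall k omega, (k < N)%N -> symmetric_mx (cR E k omega)]].

Definition flq_step (d : measure_display) (T : measurableType d)
    (R : realType) (P : probability T R) (w : nat -> {RV P >-> R})
    (n m : nat) (E : flq_data T R n m) (k : nat) (omega : T)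
    (x : 'cV[R]_n) (u : 'cV[R]_m) : 'cV[R]_n :=
  cA E k omega *m x + cB E k omega *m u + cb E k omega
  + w k omega *: (cC E k omega *m x + cD E k omega *m u + csigma E k omega).

Fixpoint flq_state (d : measure_display) (T : measurableType d)
    (R : realType) (P : probability T R) (w : nat -> {RV P >-> R})
    (n m : nat) (E : flq_data T R n m) (xi : 'cV[R]_n)
    (u : nat -> T -> 'cV[R]_m) (k : nat) (omega : T) : 'cV[R]_n :=
  if k is k'.+1 then
    flq_step w E k' omega (flq_state w E xi u k' omega) (u k' omega)
  else xi.

Definition flq_cost (d : measure_display) (T : measurableType d)
    (R : realType) (P : probability T R) (N : nat) (w : nat -> {RV P >-> R})
    (n m : nat) (E : flq_data T R n m) (xi : 'cV[R]_n)
    (u : nat -> T -> 'cV[R]_m) : \bar R :=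
  let x := flq_state w E xi u in
  ((2^-1)%:E *
   'E_P[(fun omega =>
      dot (cM E *m x 0%N omega) (x 0%N omega)
      + dot (cG E omega *m x N omega) (x N omega)
      + \sum_(k < N) (dot (cQ E k omega *m x k omega) (x k omega)
                      + dot (cR E k omega *m u k omega) (u k omega)))%R])%E.

Definition admissible (d : measure_display) (T : measurableType d)
    (R : realType) (P : probability T R) (N : nat) (w : nat -> {RV P >-> R})
    (m : nat) : set (nat -> T -> 'cV[R]_m) :=
  L2F w N.
Arguments admissible {d T R P} N w {m}.

Definition flq_optimal (d : measure_display) (T : measurableType d)
    (R : realType) (P : probability T R) (N : nat) (w : nat -> {RV P >-> R})
    (n m : nat) (E : flq_data T R n m) (xi : 'cV[R]_n)
    (u : nat -> T -> 'cV[R]_m) : Prop :=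
  admissible N w u /\
  flq_cost N w E xi u =
    ereal_inf [set flq_cost N w E xi' u' | xi' in setT & u' in admissible N w].

(* E[y_(k+1) | F_(k-1)] and E[y_(k+1) w_k | F_(k-1)]. *)
Definition adj_y' (d : measure_display) (T : measurableType d)
    (R : realType) (P : probability T R) (w : nat -> {RV P >-> R})
    (n : nat) (y : nat -> T -> 'cV[R]_n) (k : nat) : T -> 'cV[R]_n :=
  mx_cond_exp P (past w k) (y k.+1).

Definition adj_z' (d : measure_display) (T : measurableType d)
    (R : realType) (P : probability T R) (w : nat -> {RV P >-> R})
    (n : nat) (y : nat -> T -> 'cV[R]_n) (k : nat) : T -> 'cV[R]_n :=
  mx_cond_exp P (past w k) (fun omega => w k omega *: y k.+1 omega).

Definition adj_BD (d : measure_display) (T : measurableType d)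
    (R : realType) (P : probability T R) (w : nat -> {RV P >-> R})
    (n m : nat) (E : flq_data T R n m) (y : nat -> T -> 'cV[R]_n) (k : nat)
    (omega : T) : 'cV[R]_m :=
  (cB E k omega)^T *m adj_y' w y k omega
  + (cD E k omega)^T *m adj_z' w y k omega.

(* No condition is put on u, which is determined almost surely by y through
   the last equation when the matrices R_k are invertible. *)
Definition hamiltonian_solution (d : measure_display) (T : measurableType d)
    (R : realType) (P : probability T R) (N : nat) (w : nat -> {RV P >-> R})
    (n m : nat) (E : flq_data T R n m) (x y : nat -> T -> 'cV[R]_n)
    (u : nat -> T -> 'cV[R]_m) : Prop :=
  [/\ L2F w N.+1 x, L2F w N.+1 y
    & {ae P, forall omega,
      [/\ forall k, (k < N)%N ->
            x k.+1 omega = flq_step w E k omega (x k omega) (u k omega),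
          forall k, (k < N)%N ->
            y k omega = (cA E k omega)^T *m adj_y' w y k omega
                        + (cC E k omega)^T *m adj_z' w y k omega
                        + cQ E k omega *m x k omega,
          x 0%N omega = - (invmx (cM E) *m y 0%N omega),
          y N omega = cG E omega *m x N omega
        & forall k, (k < N)%N ->
            0 = adj_BD w E y k omega + cR E k omega *m u k omega]}].

(* Main.v *)
Require Import Defs.
From HB Require Import structures.
From mathcomp Require Import all_boot all_order all_algebra.
From mathcomp Require Import all_classical all_reals all_analysis.
From mathcomp Require Import measurable_realfun.
From mathcomp Require Import ring lra.

Import Order.TTheory GRing.Theory Num.Theory.
Import numFieldNormedType.Exports.
Import HBNNSimple.

Set Implicit Arguments.
Unset Strict Implicit.
Unset Printing Implicit Defensive.

Local Open Scope classical_set_scope.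
Local Open Scope ring_scope.

(** The Hamiltonian system is the optimality condition of a strictly convex
    quadratic problem. It is solved by decoupling: the adjoint is sought as an
    affine function y_k = P_k x_k + phi_k of the state. Write the transition
    as x_(k+1) = a + w_k c and stack its two coefficients into a vector
    s = AA x_k + BB u_k + bb of dimension 2n. Then x_(k+1) = [I, w_k I] s, and
    the pair (y'_(k+1), z'_(k+1)) is the conditional expectation of
    [I, w_k I]^T y_(k+1) given F_(k-1). If y_(k+1) = P_(k+1) x_(k+1) +
    phi_(k+1), this pair is Pi s + Phi, where Pi and Phi are the conditional
    expectations of [I, w_k I]^T P_(k+1) [I, w_k I] and of
    [I, w_k I]^T phi_(k+1) (cond_exp_affine). Stationarity in u_k becomes the
    linear equation (R_k + BB^T Pi BB) u_k = - BB^T (Pi (AA x_k + bb) + Phi),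
    whose matrix is at least delta I because Pi is nonnegative definite. Its
    solution is an affine feedback u_k = L_k x_k + l_k, and the adjoint
    equation then gives y_k = P_k x_k + phi_k (ric_feedback, ric_adjoint),
    where P_k is again bounded and nonnegative definite and phi_k is
    square-integrable (riccatiP). At time 0 the past is trivial, so that P_0
    and phi_0 are constant and x_0 = - M^-1 y_0 has the unique solution
    x_0 = - (M + P_0)^-1 phi_0 (initial_stateE).

    The feedback started at this point is a solution (closed_hamiltonian).
    Conversely the decoupling goes backward in time along any solution, which
    therefore follows the same feedback from the same initial state
    (hamiltonian_unique).

    For optimality, the duality between state and adjoint says that the
    expectation of <y_(k+1), h_(k+1)> - <y_k, h_k>, for h the difference of
    two state trajectories, is minus that of the terms of time k in the
    derivative of the cost (increment_mean). Hence the derivative of the cost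
    vanishes at the solution, and the cost of any other control exceeds the
    minimum by the cost of the difference in the homogeneous problem
    (flq_cost_gap), which is positive unless the initial states and the
    controls agree.

    Conditional expectations are built from the Radon-Nikodym theorem; the
    calculus needed here consists of monotonicity, the extraction of known
    factors (is_cond_expM), and a conditional Cauchy-Schwarz inequality
    (is_cond_exp_sqr_L1), which makes z' square-integrable. *)

(** * Measurability with respect to a sub-sigma-algebra *)

Section measurable_wrt_theory.
Context (T : pointedType) (R : realType).
Implicit Types (F : set (set T)) (X Y : T -> R).

(** The type g_sigma_algebraType F carries F as its sigma-algebra, so that the
    closure properties of measurable functions apply to measurable_wrt. *)
Lemma measurable_wrtE F X : sigma_algebra setT F ->
  measurable_wrt F X <->
  measurable_fun setT (X : g_sigma_algebraType F -> R).
Proof.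
move=> sF; have FE := measurable_g_measurableTypeE sF.
split=> [mX _ B mB|mX _ [B mB <-]].
  by rewrite FE; apply: mX; exists B.
by rewrite -FE; exact: mX.
Qed.

Lemma measurable_wrtS F F' X : F `<=` F' ->
  measurable_wrt F X -> measurable_wrt F' X.
Proof. by move=> FF' mX; exact: subset_trans mX FF'. Qed.

Context (F : set (set T)) (sF : sigma_algebra setT F).

Lemma measurable_wrt_cst c : measurable_wrt F (cst c : T -> R).
Proof. by apply/measurable_wrtE => //; exact: measurable_cst. Qed.

Lemma measurable_wrtD X Y : measurable_wrt F X -> measurable_wrt F Y ->
  measurable_wrt F (fun t => X t + Y t).
Proof.
by move=> /measurable_wrtE-/(_ sF) ? /measurable_wrtE-/(_ sF) ?;
  apply/measurable_wrtE => //; exact: measurable_funD.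
Qed.

Lemma measurable_wrtM X Y : measurable_wrt F X -> measurable_wrt F Y ->
  measurable_wrt F (fun t => X t * Y t).
Proof.
by move=> /measurable_wrtE-/(_ sF) ? /measurable_wrtE-/(_ sF) ?;
  apply/measurable_wrtE => //; exact: measurable_funM.
Qed.

Lemma measurable_wrtN X : measurable_wrt F X ->
  measurable_wrt F (fun t => - X t).
Proof.
move=> mX; rewrite (_ : (fun _ => _) = (fun t => cst (-1) t * X t)).
  by apply: measurable_wrtM => //; exact: measurable_wrt_cst.
by apply/funext => t; rewrite mulN1r.
Qed.

Lemma measurable_wrt_inv X : measurable_wrt F X ->
  measurable_wrt F (fun t => (X t)^-1).
Proof.
(* The inverse is not continuous at 0, but X^-1 = X * (X ^+ 2)^-1, and the
   inverse of a nonnegative number is a real power. *)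
move=> mX; rewrite (_ : (fun _ => _) =
    (fun t => X t * (fun t => (X t * X t) `^ (-1)) t)).
  apply: measurable_wrtM => //; apply/measurable_wrtE => //.
  apply: (measurableT_comp (measurable_powR (-1))).
  by apply/measurable_wrtE => //; exact: measurable_wrtM.
apply/funext => t /=; rewrite powR_inv1 -expr2 ?sqr_ge0//.
have [->|X0] := eqVneq (X t) 0; first by rewrite invr0 mul0r.
by rewrite expr2 invfM mulrA mulfV// mul1r.
Qed.

Lemma measurable_wrt_norm X : measurable_wrt F X ->
  measurable_wrt F (fun t => `|X t|).
Proof.
by move=> /measurable_wrtE-/(_ sF) ?; apply/measurable_wrtE => //;
  exact: measurableT_comp.
Qed.

Lemma measurable_wrt_sum (I : Type) (r : seq I) (p : pred I) (X : I -> T -> R) :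
  (forall i, p i -> measurable_wrt F (X i)) ->
  measurable_wrt F (fun t => \sum_(i <- r | p i) X i t).
Proof.
move=> mX; elim: r => [|i r IH].
  rewrite (_ : (fun _ => _) = cst 0); first exact: measurable_wrt_cst.
  by apply/funext => t; rewrite big_nil.
have [pi|npi] := boolP (p i).
  rewrite (_ : (fun _ => _) = (fun t => X i t + \sum_(i <- r | p i) X i t)).
    by apply: measurable_wrtD => //; exact: mX.
  by apply/funext => t; rewrite big_cons pi.
rewrite (_ : (fun _ => _) = (fun t => \sum_(i <- r | p i) X i t)) //.
by apply/funext => t; rewrite big_cons (negbTE npi).
Qed.

Lemma measurable_wrt_prod (I : Type) (r : seq I) (X : I -> T -> R) :
  (forall i, measurable_wrt F (X i)) ->
  measurable_wrt F (fun t => \prod_(i <- r) X i t).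
Proof.
move=> mX; elim: r => [|i r IH].
  rewrite (_ : (fun _ => _) = cst 1); first exact: measurable_wrt_cst.
  by apply/funext => t; rewrite big_nil.
rewrite (_ : (fun _ => _) = (fun t => X i t * \prod_(i <- r) X i t)).
  by apply: measurable_wrtM.
by apply/funext => t; rewrite big_cons.
Qed.

End measurable_wrt_theory.

(** * Conditional expectations *)

Section cond_exp_theory.
Context d (T : measurableType d) (R : realType) (P : probability T R).
Context (F : set (set T)) (sF : sigma_algebra setT F).
Hypothesis FT : F `<=` measurable.
Implicit Types (X Y Z : T -> R).

Let sigmaF (A : set T) : F.-sigma.-measurable A -> F A.
Proof. by rewrite measurable_g_measurableTypeE. Qed.

Lemma measurable_wrt_measurable X :
  measurable_wrt F X -> measurable_fun setT X.
Proof. by move=> mX _ B mB; apply/FT/mX; exists B. Qed.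

(** The restriction of P to F is the law of the identity map to (T, F). *)
Let idF (t : T) : g_sigma_algebraType F := t.

Let midF : measurable_fun setT idF.
Proof.
by move=> _ B mB; rewrite setTI; apply: FT; rewrite -(measurable_g_measurableTypeE sF).
Qed.

HB.instance Definition _ := @isMeasurableFun.Build _ _ _ _ idF midF.

Let PF := distribution P (idF : {mfun T >-> g_sigma_algebraType F}).

Let int_PF (f : T -> \bar R) A : F A ->
  measurable_fun setT (f : g_sigma_algebraType F -> \bar R) ->
  P.-integrable setT f ->
  (\int[PF]_(t in A) f t = \int[P]_(t in A) f t)%E.
Proof.
move=> FA mf fi; rewrite integral_pushforward//.
  by apply: integrableS fi => //; exact: FT.
by rewrite measurable_g_measurableTypeE.
Qed.

(** The charge A |-> E[X; A], restricted to F, is absolutely continuous with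
    respect to the restriction of P; its Radon-Nikodym density is the
    conditional expectation. *)
Lemma is_cond_exp_ex X : P.-integrable setT (EFin \o X) ->
  exists Y, is_cond_exp P F X Y.
Proof.
move=> Xi; pose nu := pushforward (induced_charge Xi) idF.
have PFnu : pushforward (induced_charge Xi) idF `<< PF.
  apply/null_content_dominatesP => A mA PA; have FA : F A.
    by rewrite -(measurable_g_measurableTypeE sF).
  apply: null_set_integral => //; first exact: FT.
  by apply: measurable_funTS; exact: measurable_int Xi.
pose f0 := Radon_Nikodym (pushforward (induced_charge Xi) idF) PF.
pose f := f0 midF.
have ffin x : f x \is a fin_num by exact: Radon_Nikodym_fin_num.
have fi : PF.-integrable setT f by exact: Radon_Nikodym_integrable.
have mf : measurable_fun setT f by exact: measurable_int fi.
have fE : EFin \o (fine \o f) = f by apply/funext => t /=; rewrite fineK.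
have fiP : P.-integrable setT (f : T -> \bar R).
  apply/integrableP; split.
    apply: (measurableT_comp (f := f) mf (g := idF)); exact: midF.
  case/integrableP : fi => _; apply: le_lt_trans.
  by rewrite ge0_integral_pushforward//; exact: measurableT_comp.
exists (fine \o f); split => //.
- by rewrite fE.
- by apply/measurable_wrtE => //; apply/measurable_EFinP; rewrite fE.
- move=> A FA; have mA : F.-sigma.-measurable A.
    by rewrite measurable_g_measurableTypeE.
  transitivity (\int[PF]_(t in A) f t)%E.
    exact: (Radon_Nikodym_integral PFnu mA).
  rewrite int_PF//; by apply: eq_integral => t _; rewrite /= fineK.
Qed.

(** The set A where Y > Y' belongs to F, and E[Y - Y'; A] = E[X - X'; A] is
    nonpositive, so A is negligible. *)
Lemma is_cond_exp_le X X' Y Y' :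
  is_cond_exp P F X Y -> is_cond_exp P F X' Y' ->
  {ae P, forall t, X t <= X' t} -> {ae P, forall t, Y t <= Y' t}.
Proof.
move=> [Xi Yi mY XY] [X'i Y'i mY' XY'] XX'.
pose A := (fun t => Y t + - Y' t) @^-1` `]0, +oo[%classic.
have FA : F A.
  have := measurable_wrtD sF mY (measurable_wrtN sF mY').
  by apply; exists `]0, +oo[%classic; rewrite ?setTI.
have mA : measurable A := FT FA.
have iS f : P.-integrable setT f -> P.-integrable A f by exact: integrableS.
have mS f : P.-integrable setT f -> measurable_fun A f.
  by move=> fi; apply: measurable_int (iS _ fi).
have YA : (\int[P]_(t in A) `|(Y t)%:E - (Y' t)%:E|)%E = 0%E.
  transitivity (\int[P]_(t in A) ((Y t)%:E - (Y' t)%:E))%E.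
    apply: eq_integral => t /set_mem At; rewrite gee0_abs// -EFinB lee_fin.
    by apply: ltW; move: At; rewrite /A /= in_itv/= andbT.
  apply/eqP; rewrite eq_le; apply/andP; split; last first.
    apply: integral_ge0 => t; rewrite /A /= in_itv/= andbT => Yt.
    by rewrite -EFinB lee_fin ltW.
  rewrite integralB//; [|exact: iS..].
  rewrite -XY// -XY'// sube_le0 -sube_ge0; last first.
    by rewrite integrable_fin_num//; exact: iS.
  rewrite -integralB//; [|exact: iS..].
  rewrite (ae_eq_integral (fun t => `|(X' t)%:E - (X t)%:E|%E))//.
  - exact: integral_ge0.
  - by apply: emeasurable_funB; exact: mS.
  - by apply: measurableT_comp => //; apply: emeasurable_funB; exact: mS.
  - by apply: filterS XX' => t XX' _; rewrite gee0_abs// -EFinB lee_fin subr_ge0.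
have /ae_eq_integral_abs : measurable_fun A (fun t => (Y t)%:E - (Y' t)%:E)%E.
  by apply: emeasurable_funB; exact: mS.
move=> /(_ P mA) [/(_ YA) + _]; apply: filterS => t AY.
rewrite leNgt; apply/negP => Yt.
have At : A t by rewrite /A /= in_itv/= andbT subr_gt0.
by move: (AY At) => /= /eqP; rewrite -EFinB eqe subr_eq0 gt_eqF.
Qed.

Lemma is_cond_exp_ae X Y Y' :
  is_cond_exp P F X Y -> is_cond_exp P F X Y' -> {ae P, forall t, Y t = Y' t}.
Proof.
move=> XY XY'; have XX : {ae P, forall t, X t <= X t} by exact: aeW.
have := is_cond_exp_le XY XY' XX; have := is_cond_exp_le XY' XY XX.
by apply: filterS2 => t Y1 Y2; apply/eqP; rewrite eq_le Y1 Y2.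
Qed.

Let integralM_nnsfun (h : {nnsfun g_sigma_algebraType F >-> R}) X :
  (forall t, 0 <= X t) -> measurable_fun setT X ->
  (\int[P]_t ((h : g_sigma_algebraType F -> R) t * X t)%:E =
   \sum_(r \in range h) (r%:E * \int[P]_(t in (h : T -> R) @^-1` [set r]) (X t)%:E))%E.
Proof.
move=> X0 mX; have mXE : measurable_fun setT (EFin \o X) by exact/measurable_EFinP.
have mh r : d.-measurable ((h : T -> R) @^-1` [set r]).
  by apply: FT; apply: sigmaF; exact: measurable_funPTI.
have mrh r : measurable_fun setT (fun t : T => (r * \1_((h : T -> R) @^-1` [set r]) t)%:E).
  by apply/measurable_EFinP; apply: measurable_funM => //; exact: measurable_indic.
transitivity (\int[P]_t (\sum_(r \in range h)
    (r * \1_((h : T -> R) @^-1` [set r]) t)%:E * (X t)%:E))%E.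
  apply: eq_integral => t _; rewrite EFinM fimfunE -fsumEFin//.
  rewrite ge0_mule_fsuml// => r; exact: nnfun_muleindic_ge0.
rewrite ge0_integral_fsum//; last 2 first.
- by move=> r; exact: emeasurable_funM.
- by move=> r t _; apply: mule_ge0; [exact: nnfun_muleindic_ge0|rewrite lee_fin].
apply: eq_fsbigr => r /[!inE] -[s _ sr].
under eq_integral do rewrite EFinM -muleA.
rewrite ge0_integralZl//.
- congr (_ * _)%E; rewrite [RHS]integral_mkcond; apply: eq_integral => t _.
  by rewrite patchE indicE; case: ifPn => _; rewrite ?mul1e ?mul0e.
- apply: emeasurable_funM => //.
  by apply/measurable_EFinP; exact: measurable_indic.
- by move=> t _; rewrite mule_ge0// lee_fin.
- by rewrite lee_fin -sr.
Qed.

(** The case of an indicator Z is the definition of conditional expectations;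
    simple functions and monotone convergence give the general case. Both
    sides may be infinite. *)
Lemma integralM_cond_exp_ge0 X Y Z : is_cond_exp P F X Y ->
  (forall t, 0 <= X t) -> (forall t, 0 <= Y t) -> (forall t, 0 <= Z t) ->
  measurable_wrt F Z ->
  (\int[P]_t (Z t * X t)%:E = \int[P]_t (Z t * Y t)%:E)%E.
Proof.
move=> [/measurable_int/measurable_EFinP mX Yi mY XY] X0 Y0 Z0 mZ.
have mZE : measurable_fun setT (EFin \o Z : g_sigma_algebraType F -> \bar R).
  by apply/measurable_EFinP; exact/measurable_wrtE.
pose h := nnsfun_approx measurableT mZE.
have cvgh t : ((h n : g_sigma_algebraType F -> R) t)%:E @[n --> \oo] --> (Z t)%:E.
  by apply: cvg_nnsfun_approx => // x _; rewrite lee_fin.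
have mh n : measurable_fun setT (h n : T -> R).
  by apply: measurable_wrt_measurable; apply/measurable_wrtE.
have limh (W : T -> R) : (forall t, 0 <= W t) -> measurable_fun setT W ->
    (\int[P]_t (Z t * W t)%:E =
      limn (fun n => \int[P]_t ((h n : T -> R) t * W t)%:E))%E.
  move=> W0 mW; rewrite -monotone_convergence//.
  - apply: eq_integral => t _; apply/esym/cvg_lim => //.
    rewrite EFinM; under eq_fun do rewrite EFinM.
    by apply: cvgeZr => //; exact: cvgh.
  - by move=> n; apply/measurable_EFinP; exact: measurable_funM.
  - by move=> n t _; rewrite lee_fin mulr_ge0.
  - move=> t _ a b ab; rewrite lee_fin ler_wpM2r//.
    by have /lefP := nd_nnsfun_approx measurableT mZE ab; apply.
rewrite !limh//; last exact: measurable_wrt_measurable.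
congr (limn _); apply/funext => n.
rewrite !integralM_nnsfun//; last exact: measurable_wrt_measurable.
apply: eq_fsbigr => r _; congr (_ * _)%E; apply: XY.
by apply: sigmaF; exact: measurable_funPTI.
Qed.

End cond_exp_theory.

Section integrable_real.
Context d (T : measurableType d) (R : realType) (P : probability T R).
Implicit Types (X Y Z : T -> R).

Local Notation L1 X := (P.-integrable setT (EFin \o X)).

Lemma L1_measurable X : L1 X -> measurable_fun setT X.
Proof. by move=> /measurable_int /measurable_EFinP. Qed.

Lemma L1_ae_le X Y : measurable_fun setT X ->
  {ae P, forall t, `|X t| <= Y t} -> L1 Y -> L1 X.
Proof.
move=> mX XY /integrableP[mY Yi]; apply/integrableP; split.
  exact/measurable_EFinP.
apply: le_lt_trans Yi; apply: ae_ge0_le_integral => //.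
- by apply: measurableT_comp => //; exact/measurable_EFinP.
- exact: measurableT_comp.
- by apply: filterS XY => t XY _; rewrite lee_fin (le_trans XY)// ler_norm.
Qed.

Lemma L1_le X Y : measurable_fun setT X ->
  (forall t, `|X t| <= Y t) -> L1 Y -> L1 X.
Proof. by move=> mX XY; apply: L1_ae_le => //; exact: aeW. Qed.

Lemma L1_norm X : L1 X -> L1 (fun t => `|X t|).
Proof. by move=> Xi; exact: integrable_norm. Qed.

Lemma L1_ae_eq X Y : measurable_fun setT Y ->
  {ae P, forall t, X t = Y t} -> L1 X -> L1 Y.
Proof.
move=> mY XY Xi; apply: (@L1_ae_le _ (fun t => `|X t|)) => //.
  by apply: filterS XY => t ->.
exact: integrable_norm.
Qed.

Lemma L1D X Y : L1 X -> L1 Y -> L1 (fun t => X t + Y t).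
Proof.
move=> Xi Yi; rewrite (_ : _ \o _ = ((EFin \o X) \+ (EFin \o Y))%E)//.
exact: integrableD.
Qed.

Lemma L1N X : L1 X -> L1 (fun t => - X t).
Proof.
move=> Xi; rewrite (_ : _ \o _ = (-%E \o (EFin \o X))%E)//.
exact: integrableN.
Qed.

Lemma L1Z c X : L1 X -> L1 (fun t => c * X t).
Proof.
move=> Xi; rewrite (_ : _ \o _ = (fun t => c%:E * (EFin \o X) t)%E)//.
exact: integrableZl.
Qed.

Lemma L1_cst c : L1 (fun=> c).
Proof. by have := @finite_measure_integrable_cst _ T R P setT c measurableT. Qed.

Lemma L1_sum (I : Type) (r : seq I) (X : I -> T -> R) :
  (forall i, L1 (X i)) -> L1 (fun t => \sum_(i <- r) X i t).
Proof.
move=> Xi; elim: r => [|i r IH].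
  by under eq_fun do rewrite big_nil; exact: L1_cst.
by under eq_fun do rewrite big_cons; exact: L1D.
Qed.

End integrable_real.
Notation "P .-L1 X" := (P.-integrable setT (EFin \o X)) (at level 2, X at level 1).

Section cond_exp_calculus.
Context d (T : measurableType d) (R : realType) (P : probability T R).
Context (F : set (set T)) (sF : sigma_algebra setT F).
Hypothesis FT : F `<=` measurable.
Implicit Types (X Y Z : T -> R).

Local Notation L1 X := (P.-integrable setT (EFin \o X)).
Local Notation CE := (is_cond_exp P F).

Lemma cond_expP X : L1 X -> CE X (cond_exp P F X).
Proof. by move=> /(is_cond_exp_ex sF FT); exact: xgetPex. Qed.

Lemma is_cond_exp_eqr X Y Y' : CE X Y -> measurable_wrt F Y' ->
  {ae P, forall t, Y t = Y' t} -> CE X Y'.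
Proof.
move=> [Xi Yi mY XY] mY' YY'.
have mYT' := measurable_wrt_measurable FT mY'.
split => //; first exact: L1_ae_eq YY' Yi.
move=> A FA; rewrite XY//; apply: ae_eq_integral.
- exact: FT.
- exact/measurable_funTS/measurable_int/Yi.
- exact/measurable_funTS/measurable_EFinP.
- by apply: filterS YY' => t -> _.
Qed.

Lemma is_cond_exp_eql X X' Y : CE X Y -> measurable_fun setT X' ->
  {ae P, forall t, X t = X' t} -> CE X' Y.
Proof.
move=> [Xi Yi mY XY] mX' XX'; split => //; first exact: L1_ae_eq XX' Xi.
move=> A FA; rewrite -XY//; apply: ae_eq_integral.
- exact: FT.
- exact/measurable_funTS/measurable_EFinP.
- exact/measurable_funTS/measurable_int/Xi.
- by apply: filterS XX' => t -> _.
Qed.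

Lemma is_cond_exp_id X : measurable_wrt F X -> L1 X -> CE X X.
Proof. by move=> mX Xi; split. Qed.

Lemma is_cond_expD X1 X2 Y1 Y2 : CE X1 Y1 -> CE X2 Y2 ->
  CE (fun t => X1 t + X2 t) (fun t => Y1 t + Y2 t).
Proof.
move=> [Xi1 Yi1 mY1 XY1] [Xi2 Yi2 mY2 XY2]; split.
- exact: L1D.
- exact: L1D.
- exact: measurable_wrtD.
- move=> A FA; have mA := FT FA.
  by rewrite !integralD_EFin ?XY1 ?XY2//; apply: integrableS measurableT _ _ _.
Qed.

Lemma is_cond_expN X Y : CE X Y -> CE (fun t => - X t) (fun t => - Y t).
Proof.
move=> [Xi Yi mY XY]; split.
- exact: L1N.
- exact: L1N.
- exact: measurable_wrtN.
- move=> A FA; have mA := FT FA.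
  have iA f : L1 f -> P.-integrable A (EFin \o f).
    by move=> fi; exact: integrableS fi.
  under eq_integral do rewrite -mulN1r EFinM.
  under [RHS]eq_integral do rewrite -mulN1r EFinM.
  by rewrite !integralZl ?XY//; exact: iA.
Qed.

Lemma is_cond_exp_sum (I : Type) (r : seq I) (X Y : I -> T -> R) :
  (forall i, CE (X i) (Y i)) ->
  CE (fun t => \sum_(i <- r) X i t) (fun t => \sum_(i <- r) Y i t).
Proof.
move=> XY; elim: r => [|i r IH].
  under eq_fun do rewrite big_nil.
  under [X in is_cond_exp _ _ _ X]eq_fun do rewrite big_nil.
  by apply: is_cond_exp_id; [exact: measurable_wrt_cst|exact: L1_cst].
under eq_fun do rewrite big_cons.
under [X in is_cond_exp _ _ _ X]eq_fun do rewrite big_cons.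
exact: is_cond_expD.
Qed.

Lemma is_cond_exp_norm_le X Y X' Y' : CE X Y -> CE X' Y' ->
  {ae P, forall t, `|X t| <= X' t} -> {ae P, forall t, `|Y t| <= Y' t}.
Proof.
move=> XY XY' XX'.
have H1 : {ae P, forall t, Y t <= Y' t}.
  apply: (is_cond_exp_le sF FT XY XY').
  by apply: filterS XX' => t; exact: le_trans (ler_norm _).
have H2 : {ae P, forall t, - Y t <= Y' t}.
  apply: (is_cond_exp_le sF FT (is_cond_expN XY) XY').
  by apply: filterS XX' => t; rewrite -normrN; exact: le_trans (ler_norm _).
by apply: filterS2 H1 H2 => t H1 H2; rewrite ler_norml lerNl H1 H2.
Qed.

Lemma measurable_wrt_pos X : measurable_wrt F X ->
  measurable_wrt F (fun t => Num.max (X t) 0).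
Proof.
move=> mX; rewrite (_ : (fun _ => _) =
    (fun t => cst 2^-1 t * (X t + `|X t|))); last first.
  apply/funext => t /=; case: (leP (X t) 0) => h.
    by rewrite ler0_norm//; lra.
  by rewrite gtr0_norm//; lra.
apply: measurable_wrtM => //; first exact: measurable_wrt_cst.
by apply: measurable_wrtD => //; exact: measurable_wrt_norm.
Qed.

Let is_cond_exp_pos X : L1 X -> (forall t, 0 <= X t) ->
  exists2 Y, CE X Y & forall t, 0 <= Y t.
Proof.
move=> Xi X0; have [Y XY] := is_cond_exp_ex sF FT Xi.
exists (fun t => Num.max (Y t) 0); last by move=> t; rewrite le_max lexx orbT.
have [_ _ mY _] := XY; apply: (is_cond_exp_eqr XY).
  exact: measurable_wrt_pos.
have C0 : CE (cst 0) (cst 0).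
  by apply: is_cond_exp_id; [exact: measurable_wrt_cst|exact: L1_cst].
have := is_cond_exp_le sF FT C0 XY (aeW P X0).
by apply: filterS => t Yt; rewrite (max_idPl _).
Qed.

Let L1_pos X : L1 X -> L1 (fun t => Num.max (X t) 0).
Proof.
move=> Xi; apply: (@L1_le _ _ _ _ _ (fun t => `|X t|)); last exact: integrable_norm.
  by apply: measurable_funrpos; exact: L1_measurable Xi.
by move=> t; case: (leP (X t) 0) => h; rewrite ?normr0.
Qed.

Let maxNE (x : R) : x = Num.max x 0 - Num.max (- x) 0.
Proof. by case: (leP x 0) => h; case: (leP (- x) 0) => h'; lra. Qed.

(** Integrability of Z X is tested on Z E[X | F]. It is used for X = 1 + w^2
    with w the noise, whose conditional expectation is the constant 2, and
    then integrability of Z suffices. *)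
Lemma is_cond_exp_ge0_L1 X Y Z : CE X Y -> (forall t, 0 <= X t) ->
  measurable_wrt F Z -> L1 (fun t => Z t * Y t) -> L1 (fun t => Z t * X t).
Proof.
move=> XY X0 mZ ZYi; have [Xi _ _ _] := XY.
have [Y' XY' Y0] := is_cond_exp_pos Xi X0.
have [_ /L1_measurable mY' _ _] := XY'.
have mZT := measurable_wrt_measurable FT mZ.
have YY' := is_cond_exp_ae sF FT XY XY'.
have /integrableP[_] : L1 (fun t => Z t * Y' t).
  apply: (L1_ae_eq _ _ ZYi); first exact: measurable_funM.
  by apply: filterS YY' => t ->.
move=> ZY'; apply/integrableP; split.
  by apply/measurable_EFinP/measurable_funM => //; exact: L1_measurable Xi.
apply: le_lt_trans ZY'.
under eq_integral do rewrite /= normrM (ger0_norm (X0 _)).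
under [leRHS]eq_integral do rewrite /= normrM (ger0_norm (Y0 _)).
rewrite (@integralM_cond_exp_ge0 _ _ _ _ F sF FT X Y' (fun t => `|Z t|))//.
exact: measurable_wrt_norm.
Qed.

Let is_cond_expM_ge0 X Y Z : CE X Y -> (forall t, 0 <= X t) ->
  (forall t, 0 <= Y t) -> (forall t, 0 <= Z t) ->
  measurable_wrt F Z -> L1 (fun t => Z t * X t) ->
  CE (fun t => Z t * X t) (fun t => Z t * Y t).
Proof.
move=> XY X0 Y0 Z0 mZ ZXi; have [Xi Yi mY _] := XY.
have mZT := measurable_wrt_measurable FT mZ.
split => //.
- apply/integrableP; split.
    by apply/measurable_EFinP/measurable_funM => //; exact: L1_measurable Yi.
  case/integrableP : ZXi => _; apply: le_lt_trans.
  under eq_integral do rewrite /= ger0_norm ?mulr_ge0//.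
  under [leRHS]eq_integral do rewrite /= ger0_norm ?mulr_ge0//.
  by rewrite -(@integralM_cond_exp_ge0 _ _ _ _ F sF FT X Y Z).
- exact: measurable_wrtM.
- move=> A FA; rewrite integral_mkcond [RHS]integral_mkcond.
  have H W : ((fun t => (Z t * W t)%:E) \_ A)%E =
      (fun t => ((\1_A t * Z t) * W t)%:E).
    apply/funext => t; rewrite patchE indicE.
    by case: (t \in A); rewrite ?mul1r// !mul0r.
  rewrite !H.
  apply: (@integralM_cond_exp_ge0 _ _ _ _ F sF FT X Y (fun t => \1_A t * Z t)) => //.
    by move=> t; apply: mulr_ge0.
  apply: measurable_wrtM => //; apply/measurable_wrtE => //.
  by apply: measurable_indic; rewrite measurable_g_measurableTypeE.
Qed.

(** Splitting X and Z into positive and negative parts reduces this to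
    nonnegative X, Y and Z, where the two sides are compared by
    integralM_cond_exp_ge0 with Z restricted to the sets of F. *)
Lemma is_cond_expM X Y Z : CE X Y -> measurable_wrt F Z ->
  L1 (fun t => Z t * X t) -> CE (fun t => Z t * X t) (fun t => Z t * Y t).
Proof.
have pos X1 Y1 Z1 : CE X1 Y1 -> (forall t, 0 <= X1 t) -> (forall t, 0 <= Y1 t) ->
    measurable_wrt F Z1 -> L1 (fun t => Z1 t * X1 t) ->
    CE (fun t => Z1 t * X1 t) (fun t => Z1 t * Y1 t).
  move=> XY1 X0 Y0 mZ1 ZXi; have [Xi1 _ _ _] := XY1.
  have half Z2 : measurable_wrt F Z2 -> (forall t, `|Z2 t| = `|Z1 t|) ->
      CE (fun t => Num.max (Z2 t) 0 * X1 t) (fun t => Num.max (Z2 t) 0 * Y1 t).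
    move=> mZ2 Z21; apply: is_cond_expM_ge0 => //.
    - by move=> t; rewrite le_max lexx orbT.
    - exact: measurable_wrt_pos.
    - apply: (L1_le _ _ (L1_norm ZXi)) => //.
        apply: measurable_funM; last exact: L1_measurable Xi1.
        exact: (measurable_wrt_measurable FT (measurable_wrt_pos mZ2)).
      move=> t /=; rewrite !normrM ler_wpM2r// -Z21.
      by case: (leP (Z2 t) 0); rewrite ?normr0.
  have := is_cond_expD (half _ mZ1 (fun=> erefl))
    (is_cond_expN (half _ (measurable_wrtN sF mZ1) (fun t => normrN _))).
  by congr CE; apply/funext => t; rewrite -mulrBl -maxNE.
move=> XY mZ ZXi; have [Xi _ mY _] := XY.
have half X' : measurable_fun setT X' -> (forall t, `|X' t| = `|X t|) -> exists2 Y',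
    CE (fun t => Num.max (X' t) 0) Y' &
    CE (fun t => Z t * Num.max (X' t) 0) (fun t => Z t * Y' t).
  move=> mX' XX'; have pX' : L1 (fun t => Num.max (X' t) 0).
    by apply: L1_pos; apply: (L1_le _ _ (L1_norm Xi)) => // t; rewrite XX'.
  have [|Y' XY' Y0] := is_cond_exp_pos pX'.
    by move=> t; rewrite le_max lexx orbT.
  exists Y' => //; apply: pos => //; first by move=> t; rewrite le_max lexx orbT.
  apply: (L1_le _ _ (L1_norm ZXi)) => //.
    apply: measurable_funM; last exact: L1_measurable pX'.
    exact: (measurable_wrt_measurable FT mZ).
  move=> t /=; rewrite !normrM ler_wpM2l// -XX'.
  by case: (leP (X' t) 0); rewrite ?normr0.
have mX := L1_measurable Xi.
have [Y1 XY1 ZXY1] := half _ mX (fun=> erefl).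
have [Y2 XY2 ZXY2] := half _ (measurable_funN mX) (fun t => normrN _).
have D := is_cond_expD XY1 (is_cond_expN XY2).
have := is_cond_expD ZXY1 (is_cond_expN ZXY2).
under eq_fun do rewrite -mulrBr -maxNE.
move=> H; apply: (is_cond_exp_eqr H); first exact: measurable_wrtM.
move: D; under eq_fun do rewrite -maxNE; move=> D.
by apply: filterS (is_cond_exp_ae sF FT D XY) => t <-; rewrite mulrBr.
Qed.

Lemma is_cond_expMr X Y Z : CE X Y -> measurable_wrt F Z ->
  L1 (fun t => X t * Z t) -> CE (fun t => X t * Z t) (fun t => Y t * Z t).
Proof.
have C (f g : T -> R) : (fun t => f t * g t) = (fun t => g t * f t).
  by apply/funext => t; rewrite mulrC.
by rewrite (C X Z) (C Y Z); exact: is_cond_expM.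
Qed.

(** Conditional Cauchy-Schwarz: the square of E[W X | F] is at most
    E[X ^ 2 | F], because E[(X - Z W) ^ 2 | F] >= 0 for the truncations Z of
    E[W X | F]. *)
Lemma is_cond_exp_sqr_L1 W X Y : CE (fun t => W t ^+ 2) (cst 1) ->
  measurable_fun setT X -> L1 (fun t => X t ^+ 2) ->
  CE (fun t => W t * X t) Y -> L1 (fun t => Y t ^+ 2).
Proof.
move=> WW mX XXi WXY; have [WXi Yi mY _] := WXY.
have [WWi _ _ _] := WW.
have [V XXV] := is_cond_exp_ex sF FT XXi; have [_ Vi mV _] := XXV.
pose Z n t := Y t * \1_[set t | `|Y t| <= n%:R] t.
have mZ n : measurable_wrt F (Z n).
  apply: measurable_wrtM => //; apply/measurable_wrtE => //.
  apply: measurable_indic; rewrite measurable_g_measurableTypeE//.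
  have := measurable_wrt_norm sF mY; apply; exists [set x | x <= n%:R].
    by rewrite -set_itvNyc; exact: measurable_itv.
  by rewrite setTI.
have Zn n t : `|Z n t| <= n%:R.
  rewrite /Z indicE; case: (boolP (t \in _)) => [/set_mem /= Yn|_].
    by rewrite mulr1.
  by rewrite mulr0 normr0.
have bd n Z' X' : measurable_wrt F Z' -> L1 X' -> (forall t, `|Z' t| <= n%:R) ->
    L1 (fun t => Z' t * X' t).
  move=> mZ' Xi' Zb; apply: (L1_le _ _ (L1Z n%:R (L1_norm Xi'))) => //.
    apply: measurable_funM; first exact: (measurable_wrt_measurable FT mZ').
    exact: L1_measurable Xi'.
  by move=> t; rewrite normrM /= ler_wpM2r.
have ae n : {ae P, forall t, 0 <= V t + (-2 * Z n t) * Y t + Z n t ^+ 2}.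
  have mZ2 : measurable_wrt F (fun t => -2 * Z n t).
    by apply: (measurable_wrtM sF _ (mZ n)); exact: measurable_wrt_cst.
  have mZZ : measurable_wrt F (fun t => Z n t ^+ 2).
    by under eq_fun do rewrite expr2; exact: measurable_wrtM.
  have H1 : CE (fun t => (-2 * Z n t) * (W t * X t)) (fun t => (-2 * Z n t) * Y t).
    apply: is_cond_expM => //; apply: (bd (2 * n)%N) => // t.
    rewrite normrM normrN (ger0_norm (_ : 0 <= 2 :> R))// natrM.
    by rewrite ler_wpM2l.
  have H2 : CE (fun t => Z n t ^+ 2 * W t ^+ 2) (fun t => Z n t ^+ 2 * cst 1 t).
    apply: is_cond_expM => //; apply: (bd (n ^ 2)%N) => // t.
    by rewrite normrX natrX lerXn2r// ?nnegrE.
  have H := is_cond_expD (is_cond_expD XXV H1) H2.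
  have C0 : CE (cst 0) (cst 0).
    by apply: is_cond_exp_id; [exact: measurable_wrt_cst|exact: L1_cst].
  apply: filterS (is_cond_exp_le sF FT C0 H _) => [t|]; first by rewrite /= mulr1.
  apply: aeW => t /=.
  by rewrite (_ : _ + _ = (X t - Z n t * W t) ^+ 2) ?sqr_ge0//; ring.
apply: (L1_ae_le _ _ Vi).
  by have := measurable_wrt_measurable FT mY; exact: measurable_funX.
apply: filterS (ae_foralln ae) => t VY.
have [n /ltW Yn] : exists n, `|Y t| < n%:R.
  by exists (Num.truncn `|Y t|).+1; exact: truncnS_gt.
have := VY n; rewrite /Z indicE mem_set// mulr1 normrX real_normK ?num_real//.
by move=> h; rewrite -subr_ge0 (_ : _ - _ = V t + -2 * Y t * Y t + Y t ^+ 2)//; ring.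
Qed.

End cond_exp_calculus.

(** * Bounded and square-integrable matrix-valued random variables *)

Section random_matrices.
Context d (T : measurableType d) (R : realType) (P : probability T R).
Implicit Types (F : set (set T)) (X Y Z : T -> R).

Definition bounded_rv F X :=
  measurable_wrt F X /\ exists c : R, {ae P, forall t, `|X t| <= c}.

Definition square_rv F X := measurable_wrt F X /\ P.-L1 (fun t => X t ^+ 2).

(** For matrices these conditions are put on the entries. In finite dimension
    this is equivalent to conditions on the norm, and stability under matrix
    products follows from sums and products of scalars. *)
Definition bounded_mx F p q (X : T -> 'M[R]_(p, q)) :=
  forall i j, bounded_rv F (fun t => X t i j).

Definition square_mx F p q (X : T -> 'M[R]_(p, q)) :=
  forall i j, square_rv F (fun t => X t i j).

Lemma ae_forall_fin (I : finType) (Q : I -> T -> Prop) :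
  (forall i, {ae P, forall t, Q i t}) -> {ae P, forall t, forall i, Q i t}.
Proof. by move=> QP; apply: filter_forall. Qed.

Lemma ae_forall_lt N (Q : nat -> T -> Prop) :
  (forall k, (k < N)%N -> {ae P, forall t, Q k t}) ->
  {ae P, forall t, forall k, (k < N)%N -> Q k t}.
Proof.
move=> QP; apply: ae_foralln => k; have [kN|kN] := ltnP k N.
  by apply: filterS (QP k kN).
by apply: aeW.
Qed.

Context (F : set (set T)) (sF : sigma_algebra setT F).
Hypothesis FT : F `<=` measurable.

Lemma bounded_cst c : bounded_rv F (cst c).
Proof.
by split; [exact: measurable_wrt_cst|exists `|c|; exact: aeW].
Qed.

Lemma boundedD X Y : bounded_rv F X -> bounded_rv F Y ->
  bounded_rv F (fun t => X t + Y t).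
Proof.
move=> [mX [a Xa]] [mY [b Yb]]; split; first exact: measurable_wrtD.
exists (a + b); apply: filterS2 Xa Yb => t Xa Yb.
by rewrite (le_trans (ler_normD _ _))// lerD.
Qed.

Lemma boundedM X Y : bounded_rv F X -> bounded_rv F Y ->
  bounded_rv F (fun t => X t * Y t).
Proof.
move=> [mX [a Xa]] [mY [b Yb]]; split; first exact: measurable_wrtM.
by exists (a * b); apply: filterS2 Xa Yb => t Xa Yb; rewrite normrM ler_pM.
Qed.

Lemma bounded_sum (I : Type) (r : seq I) (X : I -> T -> R) :
  (forall i, bounded_rv F (X i)) -> bounded_rv F (fun t => \sum_(i <- r) X i t).
Proof.
move=> bX; elim: r => [|i r IH].
  by under eq_fun do rewrite big_nil; exact: bounded_cst.
by under eq_fun do rewrite big_cons; exact: boundedD.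
Qed.

Lemma square_cst c : square_rv F (cst c).
Proof. by split; [exact: measurable_wrt_cst|exact: (L1_cst P (c ^+ 2))]. Qed.

(** (x + y)^2 <= 2 x^2 + 2 y^2. *)
Lemma squareD X Y : square_rv F X -> square_rv F Y ->
  square_rv F (fun t => X t + Y t).
Proof.
move=> [mX Xi] [mY Yi]; split; first exact: measurable_wrtD.
apply: (L1_le _ _ (L1D (L1Z 2 Xi) (L1Z 2 Yi))).
  by apply: measurable_funX; apply: (measurable_wrt_measurable FT); exact: measurable_wrtD.
move=> t; rewrite ger0_norm ?sqr_ge0// -subr_ge0.
by rewrite (_ : _ - _ = (X t - Y t) ^+ 2) ?sqr_ge0//; ring.
Qed.

Lemma square_boundedM X Y : bounded_rv F X -> square_rv F Y ->
  square_rv F (fun t => X t * Y t).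
Proof.
move=> [mX [c Xc]] [mY Yi]; split; first exact: measurable_wrtM.
apply: (L1_ae_le _ _ (L1Z (c ^+ 2) Yi)).
  by apply: measurable_funX; apply: (measurable_wrt_measurable FT); exact: measurable_wrtM.
apply: filterS Xc => t Xc.
rewrite ger0_norm ?sqr_ge0// exprMn ler_wpM2r ?sqr_ge0// -(real_normK (num_real _)).
by rewrite lerXn2r ?nnegrE// (le_trans _ Xc).
Qed.

Lemma square_sum (I : Type) (r : seq I) (X : I -> T -> R) :
  (forall i, square_rv F (X i)) -> square_rv F (fun t => \sum_(i <- r) X i t).
Proof.
move=> bX; elim: r => [|i r IH].
  by under eq_fun do rewrite big_nil; exact: square_cst.
by under eq_fun do rewrite big_cons; exact: squareD.
Qed.

Lemma squareM_L1 X Y : square_rv F X -> square_rv F Y ->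
  P.-L1 (fun t => X t * Y t).
Proof.
move=> [mX Xi] [mY Yi]; apply: (L1_le _ _ (L1D Xi Yi)).
  apply: (measurable_wrt_measurable FT); exact: measurable_wrtM.
move=> t; rewrite normrM -(real_normK (num_real (X t))) -(real_normK (num_real (Y t))).
have := sqr_ge0 (`|X t| - `|Y t|); have := mulr_ge0 (normr_ge0 (X t)) (normr_ge0 (Y t)).
by set a := `|X t|; set b := `|Y t|; nra.
Qed.

Lemma square_L1 X : square_rv F X -> P.-L1 X.
Proof.
move=> sX; have := squareM_L1 sX (square_cst 1).
by under eq_fun do rewrite mulr1.
Qed.

Section matrix_operations.
Context {p q r : nat}.
Implicit Types (A B : T -> 'M[R]_(p, q)) (C : T -> 'M[R]_(q, r)).

Lemma bounded_mx_cst (A : 'M[R]_(p, q)) : bounded_mx F (fun=> A).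
Proof. by move=> i j; exact: bounded_cst. Qed.

Lemma bounded_mxD A B : bounded_mx F A -> bounded_mx F B ->
  bounded_mx F (fun t => A t + B t).
Proof. by move=> bA bB i j; under eq_fun do rewrite mxE; exact: boundedD. Qed.

Lemma bounded_mxM A C : bounded_mx F A -> bounded_mx F C ->
  bounded_mx F (fun t => A t *m C t).
Proof.
move=> bA bC i j; under eq_fun do rewrite mxE.
by apply: bounded_sum => k; exact: boundedM.
Qed.

Lemma bounded_mxN A : bounded_mx F A -> bounded_mx F (fun t => - A t).
Proof.
move=> bA i j; under eq_fun do rewrite mxE -mulN1r.
exact: (boundedM (bounded_cst _)).
Qed.

Lemma bounded_mx_tr A : bounded_mx F A -> bounded_mx F (fun t => (A t)^T).
Proof. by move=> bA i j; under eq_fun do rewrite mxE; exact: bA. Qed.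

Lemma square_mx_cst (A : 'M[R]_(p, q)) : square_mx F (fun=> A).
Proof. by move=> i j; exact: square_cst. Qed.

Lemma square_mxD A B : square_mx F A -> square_mx F B ->
  square_mx F (fun t => A t + B t).
Proof. by move=> bA bB i j; under eq_fun do rewrite mxE; exact: squareD. Qed.

Lemma square_mxM A C : bounded_mx F A -> square_mx F C ->
  square_mx F (fun t => A t *m C t).
Proof.
move=> bA bC i j; under eq_fun do rewrite mxE.
by apply: square_sum => k; exact: square_boundedM.
Qed.

Lemma square_mxN A : square_mx F A -> square_mx F (fun t => - A t).
Proof.
move=> bA i j; under eq_fun do rewrite mxE -mulN1r.
exact: (square_boundedM (bounded_cst _)).
Qed.

End matrix_operations.

Lemma square_mxB p q (A B : T -> 'M[R]_(p, q)) : square_mx F A -> square_mx F B ->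
  square_mx F (fun t => A t - B t).
Proof. by move=> sA sB; apply: square_mxD => //; exact: square_mxN. Qed.

Lemma bounded_col_mx p1 p2 q (A : T -> 'M[R]_(p1, q)) (B : T -> 'M[R]_(p2, q)) :
  bounded_mx F A -> bounded_mx F B -> bounded_mx F (fun t => col_mx (A t) (B t)).
Proof.
move=> bA bB i j; case: (split_ordP i) => k ->.
  by under eq_fun do rewrite col_mxEu.
by under eq_fun do rewrite col_mxEd.
Qed.

Lemma square_col_mx p1 p2 q (A : T -> 'M[R]_(p1, q)) (B : T -> 'M[R]_(p2, q)) :
  square_mx F A -> square_mx F B -> square_mx F (fun t => col_mx (A t) (B t)).
Proof.
move=> bA bB i j; case: (split_ordP i) => k ->.
  by under eq_fun do rewrite col_mxEu.
by under eq_fun do rewrite col_mxEd.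
Qed.

Lemma dot_L1 n (x y : T -> 'cV[R]_n) : square_mx F x -> square_mx F y ->
  P.-L1 (fun t => dot (x t) (y t)).
Proof. by move=> sx sy; apply: L1_sum => i; exact: squareM_L1. Qed.

Lemma measurable_wrt_det n (A : T -> 'M[R]_n) : mx_measurable_wrt F A ->
  measurable_wrt F (fun t => \det (A t)).
Proof.
move=> mA; apply: measurable_wrt_sum => // s _.
apply: measurable_wrtM => //; first exact: measurable_wrt_cst.
by apply: measurable_wrt_prod.
Qed.

(** Since 0^-1 = 0, one rational expression covers both the invertible
    matrices and the singular ones, which invmx leaves unchanged; it makes the
    measurability of the inverse evident. *)
Lemma invmxE n (A : 'M[R]_n) i j : invmx A i j =
  (\det A)^-1 * (\adj A) i j + (1 - \det A * (\det A)^-1) * A i j.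
Proof.
rewrite /invmx unitmxE unitfE; have [->|dA] := eqVneq (\det A) 0.
  by rewrite invr0 !mul0r subr0 mul1r add0r.
by rewrite mulfV// subrr mul0r addr0 mxE.
Qed.

Lemma measurable_wrt_invmx n (A : T -> 'M[R]_n) : mx_measurable_wrt F A ->
  mx_measurable_wrt F (fun t => invmx (A t)).
Proof.
move=> mA i j; under eq_fun do rewrite invmxE.
have mD := measurable_wrt_det mA; have mDV := measurable_wrt_inv sF mD.
have mC c : measurable_wrt F (cst c : T -> R) by exact: measurable_wrt_cst.
apply: measurable_wrtD => //; apply: measurable_wrtM => //.
  under eq_fun do rewrite !mxE /cofactor.
  apply: measurable_wrtM => //; first exact: measurable_wrt_cst.
  apply: measurable_wrt_det => k l.
  by under eq_fun do rewrite !mxE; exact: mA.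
apply: (measurable_wrtD sF (mC 1)); apply: measurable_wrtN => //.
exact: measurable_wrtM.
Qed.

End random_matrices.

(** * Quadratic forms *)

Section quadratic_forms.
Context (R : realType).

Section dot_product.
Context (n : nat).
Implicit Types (x y z : 'cV[R]_n).

Lemma dotE x y : dot x y = (x^T *m y) 0 0.
Proof. by rewrite mxE; apply: eq_bigr => i _; rewrite mxE. Qed.

Lemma dotC x y : dot x y = dot y x.
Proof. by apply: eq_bigr => i _; rewrite mulrC. Qed.

Lemma dotDl x y z : dot (x + y) z = dot x z + dot y z.
Proof. by rewrite !dotE linearD mulmxDl mxE. Qed.

Lemma dotDr x y z : dot x (y + z) = dot x y + dot x z.
Proof. by rewrite !dotE mulmxDr mxE. Qed.

Lemma dotZl a x y : dot (a *: x) y = a * dot x y.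
Proof. by rewrite !dotE linearZ -scalemxAl mxE. Qed.

Lemma dotNl x y : dot (- x) y = - dot x y.
Proof. by rewrite -scaleN1r dotZl mulN1r. Qed.

Lemma dotNr x y : dot x (- y) = - dot x y.
Proof. by rewrite dotC dotNl dotC. Qed.

Lemma dot0l x : dot 0 x = 0.
Proof. by rewrite dotE trmx0 mul0mx mxE. Qed.

Lemma dot_ge0 x : 0 <= dot x x.
Proof. by apply: sumr_ge0 => i _; rewrite -expr2 sqr_ge0. Qed.

Lemma dot_eq0 x : dot x x = 0 -> x = 0.
Proof.
move=> /eqP; rewrite psumr_eq0 => [/allP x0|i _]; last by rewrite -expr2 sqr_ge0.
apply/matrixP => i j; rewrite ord1 mxE; have := x0 i (mem_index_enum i).
by rewrite /= mulf_eq0 orbb => /eqP.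
Qed.

Lemma le_sqr_dot x i : x i 0 ^+ 2 <= dot x x.
Proof.
rewrite /dot (bigD1 i)//= -expr2 lerDl.
by apply: sumr_ge0 => j _; rewrite -expr2 sqr_ge0.
Qed.

End dot_product.

Lemma dot_mulmx p q (A : 'M[R]_(p, q)) x y : dot (A *m x) y = dot x (A^T *m y).
Proof. by rewrite !dotE trmx_mul mulmxA. Qed.

Lemma definite_unitmx n (A : 'M[R]_n) :
  (forall x, dot (A *m x) x = 0 -> x = 0) -> A \in unitmx.
Proof.
move=> A0; rewrite -unitmx_tr -row_free_unit -kermx_eq0; apply/eqP/row_matrixP => i.
rewrite row0; apply: trmx_inj; rewrite trmx0; apply: A0.
suff -> : A *m (row i (kermx A^T))^T = 0 by rewrite dot0l.
apply: trmx_inj; rewrite trmx_mul trmxK trmx0.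
by apply/sub_kermxP; exact: row_sub.
Qed.

Lemma posdef_unitmx n (A : 'M[R]_n) : posdef A -> A \in unitmx.
Proof.
move=> pA; apply: definite_unitmx => x Ax0; apply/eqP/negP => /negP x0.
by have := pA _ x0; rewrite Ax0 ltxx.
Qed.

Section coercive.
Context (m : nat) (K : 'M[R]_m) (delta : R).
Hypotheses (d0 : 0 < delta) (Kd : nonnegdef (K - delta%:M)).

Lemma coercive_dot x : delta * dot x x <= dot (K *m x) x.
Proof.
by have := Kd x; rewrite mulmxBl mul_scalar_mx dotDl dotNl dotZl subr_ge0.
Qed.

Lemma coercive_unitmx : K \in unitmx.
Proof.
apply: definite_unitmx => x Kx; apply: dot_eq0; apply/eqP.
have := coercive_dot x; rewrite Kx (pmulr_rle0 _ d0) => xx.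
by rewrite eq_le dot_ge0 andbT.
Qed.

(** The column x of K^-1 with K x = e_j satisfies
    delta |x|^2 <= <K x, x> = x_j <= |x|. *)
Lemma coercive_invmx_le i j : `|invmx K i j| <= delta^-1.
Proof.
set x := col j (invmx K).
have Kx : K *m x = delta_mx j 0.
  by rewrite /x colE mulKVmx// coercive_unitmx.
have xj : dot (K *m x) x = x j 0.
  rewrite Kx /dot (bigD1 j)//= mxE !eqxx mul1r big1 ?addr0// => k /negPf kj.
  by rewrite mxE kj mul0r.
have := coercive_dot x; rewrite xj => h.
have xi := le_sqr_dot x i; have xjj := le_sqr_dot x j.
have -> : invmx K i j = x i 0 by rewrite mxE.
have xj0 : 0 <= x j 0 by apply: le_trans h; rewrite mulr_ge0 ?dot_ge0// ltW.
have xjd : delta * x j 0 <= 1.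
  have [->|xjn0] := eqVneq (x j 0) 0; first by rewrite mulr0.
  have xjp : 0 < x j 0 by rewrite lt_neqAle eq_sym xjn0.
  rewrite -(ler_pM2r xjp) mul1r -mulrA -expr2; apply: le_trans h.
  by rewrite ler_pM2l.
rewrite -[delta^-1]mul1r ler_pdivlMr// -(@expr_le1 _ 2)//; last first.
  by rewrite mulr_ge0// ltW.
rewrite exprMn real_normK ?num_real// mulrC expr2 -mulrA (le_trans _ xjd)//.
by rewrite ler_pM2l// (le_trans _ h)// ler_pM2l.
Qed.

End coercive.

(** Quadratic forms are continuous, so that nonnegativity needs testing on
    countably many vectors only. *)
Lemma nonnegdef_rat n (A : 'M[R]_n) :
  (forall q : 'cV[rat]_n, 0 <= dot (A *m map_mx ratr q) (map_mx ratr q)) ->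
  nonnegdef A.
Proof.
move=> A0 x.
have qx (k : nat) i : exists q : rat, `|x i 0 - ratr q| < k.+1%:R^-1.
  have [|q] := @rat_in_itvoo R (x i 0 - k.+1%:R^-1) (x i 0 + k.+1%:R^-1).
    by rewrite ltrBlDr -addrA ltrDl addr_gt0// invr_gt0.
  by rewrite in_itv/= => /andP[q1 q2]; exists q; rewrite ltr_distlC q1.
pose q k : 'cV[rat]_n := \col_i xchoose (qx k i).
pose xq k : 'cV[R]_n := map_mx ratr (q k).
have cx i : (fun k => xq k i 0) @ \oo --> x i 0.
  apply/cvgrPdist_le => e e0; near=> k; rewrite !mxE.
  apply: (le_trans (ltW (xchooseP (qx k i)))); near: k.
  by apply: filterS (near_infty_natSinv_lt (PosNum e0)) => k /ltW.
have cA : (fun k => dot (A *m xq k) (xq k)) @ \oo --> dot (A *m x) x.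
  apply: (cvg_big (op := +%R)) => [|i _]; first exact: add_continuous.
  apply: cvgM => //; under eq_fun do rewrite mxE; rewrite mxE.
  apply: (cvg_big (op := +%R)) => [|j _]; first exact: add_continuous.
  exact: cvgMl_tmp.
by apply: (cvgr_to_ge cA); apply: nearW => k; exact: A0.
Unshelve. all: by end_near.
Qed.

End quadratic_forms.

(** * Matrix-valued conditional expectations *)

Section matrix_cond_exp.
Context d (T : measurableType d) (R : realType) (P : probability T R).
Context (F : set (set T)) (sF : sigma_algebra setT F).
Hypothesis FT : F `<=` measurable.

Lemma bounded_invmx n (K : T -> 'M[R]_n) delta : 0 < delta ->
  bounded_mx P F K -> {ae P, forall t, nonnegdef (K t - delta%:M)} ->
  bounded_mx P F (fun t => invmx (K t)).
Proof.
move=> d0 bK Kd i j; split.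
  by apply: measurable_wrt_invmx => // k l; have [] := bK k l.
by exists delta^-1; apply: filterS Kd => t Kd; exact: coercive_invmx_le.
Qed.

Definition is_mx_cond_exp p q (X Y : T -> 'M[R]_(p, q)) :=
  forall i j, is_cond_exp P F (fun t => X t i j) (fun t => Y t i j).

Lemma mx_cond_expP p q (X : T -> 'M[R]_(p, q)) :
  (forall i j, P.-L1 (fun t => X t i j)) ->
  is_mx_cond_exp X (mx_cond_exp P F X).
Proof.
move=> Xi i j; under [X in is_cond_exp _ _ _ X]eq_fun do rewrite mxE.
exact: cond_expP.
Qed.

Lemma is_mx_cond_exp_ae p q (X Y Y' : T -> 'M[R]_(p, q)) :
  is_mx_cond_exp X Y -> is_mx_cond_exp X Y' -> {ae P, forall t, Y t = Y' t}.
Proof.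
move=> XY XY'.
have : {ae P, forall t, forall i j, Y t i j = Y' t i j}.
  apply: ae_forall_fin => i; apply: ae_forall_fin => j.
  exact: is_cond_exp_ae (XY i j) (XY' i j).
by apply: filterS => t YY'; apply/matrixP.
Qed.

Lemma is_mx_cond_expD p q (X1 X2 Y1 Y2 : T -> 'M[R]_(p, q)) :
  is_mx_cond_exp X1 Y1 -> is_mx_cond_exp X2 Y2 ->
  is_mx_cond_exp (fun t => X1 t + X2 t) (fun t => Y1 t + Y2 t).
Proof.
move=> XY1 XY2 i j; under eq_fun do rewrite mxE.
under [X in is_cond_exp _ _ _ X]eq_fun do rewrite mxE.
exact: is_cond_expD.
Qed.

Lemma is_mx_cond_expM p q r (X Y : T -> 'M[R]_(p, q)) (Z : T -> 'M[R]_(q, r)) :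
  is_mx_cond_exp X Y -> mx_measurable_wrt F Z ->
  (forall i k j, P.-L1 (fun t => X t i k * Z t k j)) ->
  is_mx_cond_exp (fun t => X t *m Z t) (fun t => Y t *m Z t).
Proof.
move=> XY mZ XZ i j; under eq_fun do rewrite mxE.
under [X in is_cond_exp _ _ _ X]eq_fun do rewrite mxE.
by apply: is_cond_exp_sum => // k; apply: is_cond_expMr.
Qed.

Lemma is_cond_exp_dot n (X Y Z : T -> 'cV[R]_n) :
  is_mx_cond_exp X Y -> mx_measurable_wrt F Z ->
  (forall i, P.-L1 (fun t => X t i 0 * Z t i 0)) ->
  is_cond_exp P F (fun t => dot (X t) (Z t)) (fun t => dot (Y t) (Z t)).
Proof.
move=> XY mZ XZ; by apply: is_cond_exp_sum => // i; apply: is_cond_expMr.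
Qed.

(** Monotonicity gives the inequality almost surely at each rational vector,
    hence almost surely at all of them at once, which is enough by continuity
    (nonnegdef_rat). *)
Lemma is_mx_cond_exp_nonnegdef n (X Y : T -> 'M[R]_n) : is_mx_cond_exp X Y ->
  {ae P, forall t, nonnegdef (X t)} -> {ae P, forall t, nonnegdef (Y t)}.
Proof.
move=> XY X0.
have rat_ae (q : 'cV[rat]_n) :
    {ae P, forall t, 0 <= dot (Y t *m map_mx ratr q) (map_mx ratr q)}.
  set v : 'cV[R]_n := map_mx ratr q.
  have mv : mx_measurable_wrt F (fun=> v : 'cV[R]_n).
    by move=> i j; exact: (measurable_wrt_cst sF).
  have XYv : is_mx_cond_exp (fun t => X t *m v) (fun t => Y t *m v).
    apply: is_mx_cond_expM => // i k j; have [Xi _ _ _] := XY i k.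
    by under eq_fun do rewrite mulrC; exact: L1Z.
  have XYvv : is_cond_exp P F (fun t => dot (X t *m v) v) (fun t => dot (Y t *m v) v).
    apply: (is_cond_exp_dot XYv mv) => i; have [Xi _ _ _] := XYv i 0.
    by under eq_fun do rewrite mulrC; exact: L1Z.
  have C0 : is_cond_exp P F (cst 0) (cst 0).
    by apply: is_cond_exp_id; [exact: measurable_wrt_cst|exact: L1_cst].
  apply: (is_cond_exp_le sF FT C0 XYvv).
  by apply: filterS X0 => t; apply.
(* Countably many almost sure statements hold simultaneously. *)
pose Q k t : Prop := if unpickle k is Some q
  then is_true (0 <= dot (Y t *m map_mx ratr q) (map_mx ratr q)) else True.
have : {ae P, forall t, forall k, Q k t}.
  apply: ae_foralln => k; rewrite /Q; case: (unpickle k) => [q|]; last exact: aeW.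
  exact: rat_ae.
apply: filterS => t Qt; apply: nonnegdef_rat => q.
by have := Qt (pickle q); rewrite /Q pickleK.
Qed.

End matrix_cond_exp.

(** * One step of noise *)

Section noise.
Context (R : realType).

(** The transition x' = a + w c reads x' = noise_row w *m col_mx a c, and the
    transpose maps an adjoint y to the pair (y, w y) whose conditional means
    enter the Hamiltonian system. *)
Definition noise_row n (w : R) : 'M[R]_(n, n + n) := row_mx 1%:M w%:M.

Lemma noise_rowE n w (a c : 'cV[R]_n) :
  noise_row n w *m col_mx a c = a + w *: c.
Proof. by rewrite mul_row_col mul1mx mul_scalar_mx. Qed.

Lemma noise_row_trE n w (y : 'cV[R]_n) :
  (noise_row n w)^T *m y = col_mx y (w *: y).
Proof. by rewrite tr_row_mx mul_col_mx trmx1 mul1mx tr_scalar_mx mul_scalar_mx. Qed.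

Lemma noise_row_le n w i j : `|noise_row n w i j| <= 1 + `|w|.
Proof.
rewrite /noise_row; case: (split_ordP j) => k ->;
  rewrite ?row_mxEl ?row_mxEr mxE; case: (_ == _);
  rewrite ?mulr1n ?mulr0n ?normr1 ?normr0.
- by rewrite lerDl.
- by rewrite addr_ge0.
- by rewrite lerDr.
- by rewrite addr_ge0.
Qed.

(** The quadratic form <A x', x'> pulled back along x' = noise_row w *m s. *)
Definition noise_quad n (w : R) (A : 'M[R]_n) : 'M[R]_(n + n) :=
  (noise_row n w)^T *m A *m noise_row n w.

Lemma noise_quad_nonnegdef n w (A : 'M[R]_n) :
  nonnegdef A -> nonnegdef (noise_quad w A).
Proof. by move=> A0 x; rewrite /noise_quad -!mulmxA dot_mulmx trmxK; exact: A0. Qed.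

End noise.

Section noise_step.
Context d (T : measurableType d) (R : realType) (P : probability T R).
Context (F F' : set (set T)) (sF : sigma_algebra setT F).
Context (sF' : sigma_algebra setT F').
Hypotheses (FF' : F `<=` F') (F'T : F' `<=` measurable).
Context (w : T -> R).
Hypotheses (mw : measurable_wrt F' w)
  (ww : is_cond_exp P F (fun t => w t ^+ 2) (cst 1)).

Let FT : F `<=` measurable := subset_trans FF' F'T.

Let ww1 : is_cond_exp P F (fun t => 1 + w t ^+ 2) (cst 2).
Proof.
rewrite (_ : cst 2 = fun t : T => cst 1 t + cst 1 t)//.
apply: is_cond_expD => //; apply: is_cond_exp_id; first exact: measurable_wrt_cst.
exact: L1_cst.
Qed.

(** Since E[w^2 | F] = 1, a factor of growth 1 + w^2 preserves the
    integrability of the variables known given F. *)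
Lemma noise_L1 c (X Z : T -> R) : measurable_wrt F' X ->
  {ae P, forall t, `|X t| <= c * (1 + w t ^+ 2)} ->
  measurable_wrt F Z -> P.-L1 Z -> P.-L1 (fun t => X t * Z t).
Proof.
move=> mX Xc mZ Zi.
have H : P.-L1 (fun t => Z t * (1 + w t ^+ 2)).
  apply: (is_cond_exp_ge0_L1 sF FT ww1) => //.
    by move=> t; rewrite addr_ge0// sqr_ge0.
  by under eq_fun do rewrite mulrC; exact: L1Z.
apply: (L1_ae_le _ _ (L1Z c (L1_norm H))).
  apply: (measurable_wrt_measurable F'T); apply: measurable_wrtM => //.
  exact: measurable_wrtS mZ.
apply: filterS Xc => t Xc; rewrite !normrM (ger0_norm (_ : 0 <= 1 + w t ^+ 2)).
  by rewrite [leRHS]mulrCA mulrC ler_wpM2l.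
by rewrite addr_ge0// sqr_ge0.
Qed.

(** (1 + |w|)^2 <= 2 (1 + w^2). *)
Lemma noise_square (X Z : T -> R) : measurable_wrt F' X ->
  (forall t, `|X t| <= 1 + `|w t|) -> square_rv P F Z ->
  square_rv P F' (fun t => X t * Z t).
Proof.
move=> mX Xw [mZ Zi]; split.
  by apply: measurable_wrtM => //; exact: measurable_wrtS mZ.
under eq_fun do rewrite exprMn.
apply: (@noise_L1 2) => //.
- by under eq_fun do rewrite expr2; exact: measurable_wrtM.
- apply: aeW => t; rewrite normrX.
  apply: (@le_trans _ _ ((1 + `|w t|) ^+ 2)); first by rewrite lerXn2r ?nnegrE ?addr_ge0.
  rewrite -(real_normK (num_real (w t))) -subr_ge0.
  by rewrite (_ : _ - _ = (1 - `|w t|) ^+ 2) ?sqr_ge0//; ring.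
- by under eq_fun do rewrite expr2; exact: measurable_wrtM.
Qed.

Lemma noise_row_measurable n i j : measurable_wrt F' (fun t => noise_row n (w t) i j).
Proof.
rewrite /noise_row; case: (split_ordP j) => k ->.
  by under eq_fun do rewrite row_mxEl; exact: measurable_wrt_cst.
under eq_fun do rewrite row_mxEr mxE.
case: (_ == _); under eq_fun do rewrite ?mulr1n ?mulr0n; first exact: mw.
exact: measurable_wrt_cst.
Qed.

Lemma square_noise n (s : T -> 'cV[R]_(n + n)) : square_mx P F s ->
  square_mx P F' (fun t => noise_row n (w t) *m s t).
Proof.
move=> ss i j; under eq_fun do rewrite mxE.
apply: square_sum => // k; apply: noise_square => //.
  exact: noise_row_measurable.
by move=> t; exact: noise_row_le.
Qed.

Lemma noise_tr_L1 n (y : T -> 'cV[R]_n) : square_mx P F' y ->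
  forall i j, P.-L1 (fun t => ((noise_row n (w t))^T *m y t) i j).
Proof.
move=> sy i j; under eq_fun do rewrite mxE; apply: L1_sum => k.
apply: (squareM_L1 sF' F'T) => //; split; under eq_fun do rewrite mxE.
  exact: noise_row_measurable.
have [_] := @noise_square (fun t => noise_row n (w t) k i) (cst 1)
  (@noise_row_measurable n k i) (fun t => noise_row_le _ _ _) (square_cst P sF 1).
by under eq_fun do rewrite mulr1.
Qed.

(** The conditional Cauchy-Schwarz inequality applies to y with weight 1 and to
    w y with weight w. *)
Lemma square_noise_cond_exp n (y Y : T -> 'M[R]_(_, 1)) : square_mx P F' y ->
  is_mx_cond_exp P F (fun t => (noise_row n (w t))^T *m y t) Y -> square_mx P F Y.
Proof.
move=> sy yY i j; have [_ _ mY _] := yY i j; split => //.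
move: (yY i j); under eq_fun do rewrite noise_row_trE.
case: (split_ordP i) => k ->.
  under eq_fun do rewrite col_mxEu; have [mk ki] := sy k j.
  rewrite (_ : (fun t => y t k j) = (fun t => cst 1 t * y t k j)); last first.
    by apply/funext => t; rewrite mul1r.
  apply: is_cond_exp_sqr_L1 => //; last exact: measurable_wrt_measurable mk.
  under eq_fun do rewrite expr1n.
  by apply: is_cond_exp_id; [exact: measurable_wrt_cst|exact: L1_cst].
under eq_fun do rewrite col_mxEd mxE; have [mk ki] := sy k j.
by apply: is_cond_exp_sqr_L1 => //; exact: measurable_wrt_measurable mk.
Qed.

(** The entries of noise_row are at most 1 + |w|, and
    (1 + |w|)^2 <= 2 (1 + w^2). *)
Let noise_quad_le n (A : T -> 'M[R]_n) : bounded_mx P F' A ->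
  forall i j, measurable_wrt F' (fun t => noise_quad (w t) (A t) i j) /\
  exists c : R, {ae P, forall t, `|noise_quad (w t) (A t) i j| <= c * (1 + w t ^+ 2)}.
Proof.
move=> bA i j; split.
  under eq_fun do rewrite mxE; apply: measurable_wrt_sum => // k _.
  apply: measurable_wrtM => //; last exact: noise_row_measurable.
  under eq_fun do rewrite mxE; apply: measurable_wrt_sum => // l _.
  apply: measurable_wrtM => //; last by have [] := bA l k.
  by under eq_fun do rewrite mxE; exact: noise_row_measurable.
have [c cA] : exists c : 'I_n -> 'I_n -> R,
    forall k l, {ae P, forall t, `|A t k l| <= c k l}.
  have /choice[c cA] : forall kl : 'I_n * 'I_n,
      exists c : R, {ae P, forall t, `|A t kl.1 kl.2| <= c}.
    by move=> [k l]; have [] := bA k l.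
  by exists (fun k l => c (k, l)) => k l; exact: (cA (k, l)).
exists (\sum_k \sum_l 2 * c l k).
have : {ae P, forall t, forall k l, `|A t k l| <= c k l}.
  by apply: ae_forall_fin => k; apply: ae_forall_fin => l.
apply: filterS => t At; rewrite mxE mulr_suml.
apply: (le_trans (ler_norm_sum _ _ _)); apply: ler_sum => k _.
rewrite mxE !mulr_suml; apply: (le_trans (ler_norm_sum _ _ _)).
apply: ler_sum => l _; rewrite mxE !normrM.
have := noise_row_le (w t) l i; have := noise_row_le (w t) k j; have := At l k.
rewrite -(real_normK (num_real (w t))).
set a := `|A t l k|; set x := `|noise_row _ _ _ _|; set y := `|noise_row _ _ _ _|.
move=> ac xw yw; have a0 : 0 <= a by exact: normr_ge0.
have x0 : 0 <= x by exact: normr_ge0.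
have y0 : 0 <= y by exact: normr_ge0.
have c0 : 0 <= c l k by exact: le_trans ac.
have yx : y * x <= 2 * (1 + `|w t| ^+ 2).
  apply: (@le_trans _ _ ((1 + `|w t|) * (1 + `|w t|))); first by rewrite ler_pM.
  by rewrite -subr_ge0 (_ : _ - _ = (1 - `|w t|) ^+ 2) ?sqr_ge0//; ring.
rewrite mulrAC [leRHS]mulrAC; apply: ler_pM => //; first by rewrite mulr_ge0.
Qed.

Context {n : nat} (A : T -> 'M[R]_n) (phi : T -> 'cV[R]_n).
Hypotheses (bA : bounded_mx P F' A) (sphi : square_mx P F' phi).

Definition noise_quad_mean : T -> 'M[R]_(n + n) :=
  mx_cond_exp P F (fun t => noise_quad (w t) (A t)).

Definition noise_lin_mean : T -> 'cV[R]_(n + n) :=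
  mx_cond_exp P F (fun t => (noise_row n (w t))^T *m phi t).

Lemma noise_quad_meanP :
  is_mx_cond_exp P F (fun t => noise_quad (w t) (A t)) noise_quad_mean.
Proof.
apply: mx_cond_expP => // i j; have [mA [c cA]] := noise_quad_le bA i j.
have := noise_L1 mA cA (measurable_wrt_cst sF (c := 1)) (L1_cst P 1).
by under eq_fun do rewrite mulr1.
Qed.

Lemma noise_lin_meanP :
  is_mx_cond_exp P F (fun t => (noise_row n (w t))^T *m phi t) noise_lin_mean.
Proof. by apply: mx_cond_expP => //; exact: noise_tr_L1. Qed.

Lemma noise_quad_mean_bounded : bounded_mx P F noise_quad_mean.
Proof.
move=> i j; have H := noise_quad_meanP i j; have [_ _ mH _] := H; split => //.
have [mA [c cA]] := noise_quad_le bA i j; exists (c * 2).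
have Hc : is_cond_exp P F (fun t => c * (1 + w t ^+ 2)) (fun t => c * cst 2 t).
  apply: is_cond_expM => //; first exact: (measurable_wrt_cst sF).
  by apply: L1Z; case: ww1.
exact: is_cond_exp_norm_le H Hc cA.
Qed.

Lemma noise_quad_mean_nonnegdef : {ae P, forall t, nonnegdef (A t)} ->
  {ae P, forall t, nonnegdef (noise_quad_mean t)}.
Proof.
move=> A0; apply: (is_mx_cond_exp_nonnegdef sF FT noise_quad_meanP).
by apply: filterS A0 => t; exact: noise_quad_nonnegdef.
Qed.

Lemma noise_lin_mean_square : square_mx P F noise_lin_mean.
Proof. exact: square_noise_cond_exp noise_lin_meanP. Qed.

(** The vector s is known given F, so only the coefficients are averaged. *)
Lemma cond_exp_affine (s : T -> 'cV[R]_(n + n)) : square_mx P F s ->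
  is_mx_cond_exp P F
    (fun t => (noise_row n (w t))^T *m (A t *m (noise_row n (w t) *m s t) + phi t))
    (fun t => noise_quad_mean t *m s t + noise_lin_mean t).
Proof.
move=> ss.
rewrite (_ : (fun t => (noise_row n (w t))^T *m _) = (fun t =>
    noise_quad (w t) (A t) *m s t + (noise_row n (w t))^T *m phi t)); last first.
  by apply/funext => t; rewrite mulmxDr /noise_quad !mulmxA.
apply: is_mx_cond_expD => //; last exact: noise_lin_meanP.
apply: is_mx_cond_expM => //; first exact: noise_quad_meanP.
  by move=> i j; have [] := ss i j.
move=> i k j; have [mA [c cA]] := noise_quad_le bA i k.
have [ms _] := ss k j; apply: (noise_L1 mA cA ms).
exact: (square_L1 sF FT (ss k j)).
Qed.

End noise_step.

(** * The Riccati step *)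

(** Here x is the state, u the control, and s = A x + B u + b the stacked
    transition; Pi and Phi are the averaged coefficients of the next adjoint,
    Q and S the running costs of x and u. *)
Section riccati_step.
Context (R : realType) (n m N : nat).
Context (Pi : 'M[R]_N) (A : 'M[R]_(N, n)) (B : 'M[R]_(N, m)).
Context (b Phi : 'cV[R]_N) (Q : 'M[R]_n) (S : 'M[R]_m).

Definition ric_K : 'M[R]_m := S + B^T *m Pi *m B.
Definition ric_L : 'M[R]_(m, n) := - (invmx ric_K *m (B^T *m Pi *m A)).
Definition ric_l : 'cV[R]_m := - (invmx ric_K *m (B^T *m (Pi *m b + Phi))).
Definition ric_P : 'M[R]_n := Q + A^T *m Pi *m (A + B *m ric_L).
Definition ric_phi : 'cV[R]_n := A^T *m (Pi *m (B *m ric_l + b) + Phi).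

(** The stationarity condition in u is affine with matrix K; its zero is the
    feedback L x + l. *)
Lemma ric_gradient x u : ric_K \in unitmx ->
  B^T *m (Pi *m (A *m x + B *m u + b) + Phi) + S *m u =
  ric_K *m (u - (ric_L *m x + ric_l)).
Proof.
move=> uK; rewrite /ric_L /ric_l mulmxBr (mulmxDr ric_K) !mulNmx !mulmxN -!mulmxA.
rewrite !mulKVmx// /ric_K mulmxDl !mulmxDr -!mulmxA.
set e1 := B^T *m (Pi *m (A *m x)); set e2 := B^T *m (Pi *m (B *m u)).
set e3 := B^T *m (Pi *m b); set e4 := B^T *m Phi; set e5 := S *m u.
by clearbody e1 e2 e3 e4 e5; apply/matrixP => i j; rewrite !mxE; ring.
Qed.

Lemma ric_feedback x u : ric_K \in unitmx ->
  0 = B^T *m (Pi *m (A *m x + B *m u + b) + Phi) + S *m u ->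
  u = ric_L *m x + ric_l.
Proof.
move=> uK; rewrite ric_gradient// => /(congr1 (mulmx (invmx ric_K))).
by rewrite mulmx0 mulKmx// => /esym/eqP; rewrite subr_eq0 => /eqP.
Qed.

Lemma ric_stationary x : ric_K \in unitmx ->
  0 = B^T *m (Pi *m (A *m x + B *m (ric_L *m x + ric_l) + b) + Phi)
      + S *m (ric_L *m x + ric_l).
Proof. by move=> uK; rewrite ric_gradient// subrr mulmx0. Qed.

(** Inserting the feedback in the adjoint equation gives the Riccati step. *)
Lemma ric_adjoint x u : u = ric_L *m x + ric_l ->
  A^T *m (Pi *m (A *m x + B *m u + b) + Phi) + Q *m x = ric_P *m x + ric_phi.
Proof.
move=> ->; rewrite /ric_P /ric_phi !mulmxDl !mulmxDr !mulmxDl -!mulmxA.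
set e1 := A^T *m (Pi *m (A *m x)); set e2 := A^T *m (Pi *m (B *m (ric_L *m x))).
set e3 := A^T *m (Pi *m (B *m ric_l)); set e4 := A^T *m (Pi *m b).
set e5 := A^T *m Phi; set e6 := Q *m x.
by clearbody e1 e2 e3 e4 e5 e6; apply/matrixP => i j; rewrite !mxE; ring.
Qed.

(** P = Q + (A + B L)^T Pi (A + B L) + L^T S L is the cost-to-go of the
    feedback u = L x. *)
Lemma ric_P_nonnegdef : ric_K \in unitmx ->
  nonnegdef Pi -> nonnegdef Q -> nonnegdef S -> nonnegdef ric_P.
Proof.
move=> uK Pi0 Q0 S0 x; set v := (A + B *m ric_L) *m x.
have BPv : B^T *m (Pi *m v) = - (S *m (ric_L *m x)).
  apply/eqP; rewrite -addr_eq0; apply/eqP.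
  have KL : ric_K *m (ric_L *m x) = - (B^T *m (Pi *m (A *m x))).
    by rewrite /ric_L mulNmx mulmxN -!mulmxA mulKVmx.
  have KL' : ric_K *m (ric_L *m x) = S *m (ric_L *m x) + B^T *m (Pi *m (B *m (ric_L *m x))).
    by rewrite {1}/ric_K mulmxDl -!mulmxA.
  rewrite /v mulmxDl !mulmxDr -(mulmxA B) -addrA [X in _ + X]addrC -KL' KL.
  by rewrite subrr.
have Ax : A *m x = v - B *m (ric_L *m x) by rewrite /v mulmxDl -(mulmxA B) addrK.
rewrite /ric_P mulmxDl dotDl addr_ge0// -!mulmxA -/v dot_mulmx trmxK Ax.
rewrite dotDr addr_ge0// dotNr -{1}(trmxK B) dotC dot_mulmx trmxK BPv dotNr opprK.
by rewrite dotC.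
Qed.

End riccati_step.

(** * The filtration generated by the noise *)

Section filtration.
Context d (T : measurableType d) (R : realType) (P : probability T R).
Context (w : nat -> {RV P >-> R}).

Lemma past_sigma k : sigma_algebra setT (past w k).
Proof. exact: smallest_sigma_algebra. Qed.

Let pastE k : past w k =
  <<s \bigcup_(i in `I_k) preimage_set_system setT (w i) measurable >>.
Proof. by rewrite bigcup_mkord. Qed.

Lemma past_measurable k : past w k `<=` measurable.
Proof.
rewrite pastE; apply: smallest_sub; first exact: sigma_algebra_measurable.
by move=> _ [i _] [B mB <-]; exact: measurable_funP.
Qed.

Lemma pastS k : past w k `<=` past w k.+1.
Proof.
rewrite !pastE; apply: sub_sigma_algebra2.
by move=> A [i /= ik wA]; exists i => //=; exact: ltnW.
Qed.

Lemma past_noise k : measurable_wrt (past w k.+1) (w k).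
Proof.
rewrite pastE => A wA; apply: sub_gen_smallest.
by exists k => /=.
Qed.

(** The sigma-algebra generated by the empty family is {set0, setT}. *)
Lemma past0_cst (X : T -> R) t t' : measurable_wrt (past w 0) X -> X t = X t'.
Proof.
move=> mX; have : past w 0 (X @^-1` [set X t]).
  by apply: mX; exists [set X t]; rewrite ?setTI.
rewrite /past /g_sigma_preimage big_ord0 => h.
have {h} : [set set0; setT] (X @^-1` [set X t]).
  apply: h; split; last by [].
  split.
  - by left.
  - by move=> A [->|->]; [right; rewrite setD0|left; rewrite setDv].
  - move=> A hA; have [[i Ai]|nA] := pselect (exists i, A i = setT).
      by right; apply/seteqP; split=> // x _; exists i => //; rewrite Ai.
    left; apply/seteqP; split=> // x [i _]; case: (hA i) => [->//|Ai].
    by case: nA; exists i.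
move=> [/seteqP[/(_ t) h _]|/seteqP[_ /(_ t')]]; first by case: h.
by move=> /(_ I) /= ->.
Qed.

Lemma past0_mx_cst p q (X : T -> 'M[R]_(p, q)) t t' :
  mx_measurable_wrt (past w 0) X -> X t = X t'.
Proof.
by move=> mX; apply/matrixP => i j; exact: past0_cst (mX i j).
Qed.

Lemma fnorm_sqr p q (A : 'M[R]_(p, q)) :
  fnorm A ^+ 2 = \sum_(i < p) \sum_(j < q) A i j ^+ 2.
Proof.
rewrite sqr_sqrtr//; apply: sumr_ge0 => i _; apply: sumr_ge0 => j _.
exact: sqr_ge0.
Qed.

Lemma sqr_le_fnorm p q (A : 'M[R]_(p, q)) i j : A i j ^+ 2 <= fnorm A ^+ 2.
Proof.
rewrite fnorm_sqr (bigD1 i)//= (bigD1 j)//= -addrA lerDl addr_ge0//.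
  by apply: sumr_ge0 => k _; exact: sqr_ge0.
by apply: sumr_ge0 => k _; apply: sumr_ge0 => l _; exact: sqr_ge0.
Qed.

Lemma L2FP K p q (h : nat -> T -> 'M[R]_(p, q)) :
  L2F w K h <-> forall k, (k < K)%N -> square_mx P (past w k) (h k).
Proof.
split=> [[mh hi] k kK i j|sh].
  split; first exact: mh.
  have mS : measurable_fun setT (fun t => \sum_(l < K) fnorm (h l t) ^+ 2).
    apply: measurable_sum => l; under eq_fun do rewrite fnorm_sqr.
    apply: measurable_sum => i'; apply: measurable_sum => j'.
    apply: measurable_funX; apply: (measurable_wrt_measurable (@past_measurable l)).
    exact: mh.
  apply: (@L1_le _ _ _ _ _ (fun t => \sum_(l < K) fnorm (h l t) ^+ 2)).
  - apply: measurable_funX.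
    exact: (measurable_wrt_measurable (@past_measurable k) (mh k kK i j)).
  - move=> t; rewrite ger0_norm ?sqr_ge0// (le_trans (sqr_le_fnorm _ _ _))//.
    rewrite (bigD1 (Ordinal kK))//= lerDl.
    by apply: sumr_ge0 => l _; exact: sqr_ge0.
  - apply/integrableP; split; first exact/measurable_EFinP.
    move: hi; rewrite unlock; under eq_integral => t _.
      rewrite -[X in X%:E]ger0_norm; last by apply: sumr_ge0 => l _; exact: sqr_ge0.
      over.
    by [].
split=> [k kK i j|]; first by have [] := sh k kK i j.
rewrite unlock; apply: integrable_lty => //.
apply: L1_sum => l; under eq_fun do rewrite fnorm_sqr.
apply: L1_sum => i; apply: L1_sum => j.
by have [] := sh l (ltn_ord l) i j.
Qed.

Lemma ess_bounded_entry F p q (X : T -> 'M[R]_(p, q)) :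
  mx_measurable_wrt F X -> ess_bounded P X -> bounded_mx P F X.
Proof.
move=> mX [c Xc] i j; split; first exact: mX.
exists c; apply: filterS Xc => t; apply: le_trans.
rewrite -(@ler_pXn2r _ 2)// ?nnegrE ?sqrtr_ge0//.
by rewrite real_normK ?num_real// sqr_le_fnorm.
Qed.

Lemma LooFP K p q (h : nat -> T -> 'M[R]_(p, q)) k : LooF w K h -> (k < K)%N ->
  bounded_mx P (past w k) (h k).
Proof. by move=> [mh bh] kK; apply: ess_bounded_entry; [exact: mh|exact: bh]. Qed.

End filtration.

(** * The Hamiltonian system *)

Section hamiltonian.
Context d (T : measurableType d) (R : realType) (P : probability T R).
Context (N : nat) (w : nat -> {RV P >-> R}) (hw : mart_diff N w).
Context (n m : nat) (E : flq_data T R n m) (hE : flq_setting N w E).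
Hypothesis hM : posdef (cM E).
Hypothesis hG : forall t, nonnegdef (cG E t).
Hypothesis hQ : forall t k, (k < N)%N -> nonnegdef (cQ E k t).
Context (delta : R) (delta0 : 0 < delta).
Hypothesis hR : forall t k, (k < N)%N -> nonnegdef (cR E k t - delta%:M).

Definition stack_A k t : 'M[R]_(n + n, n) := col_mx (cA E k t) (cC E k t).
Definition stack_B k t : 'M[R]_(n + n, m) := col_mx (cB E k t) (cD E k t).
Definition stack_b k t : 'cV[R]_(n + n) := col_mx (cb E k t) (csigma E k t).

(** The pair of the drift and the noise coefficient of the state. *)
Definition transition k t (x : 'cV[R]_n) (u : 'cV[R]_m) : 'cV[R]_(n + n) :=
  stack_A k t *m x + stack_B k t *m u + stack_b k t.

Lemma flq_stepE k t x u :
  flq_step w E k t x u = noise_row n (w k t) *m transition k t x u.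
Proof.
by rewrite /transition !mul_col_mx !add_col_mx noise_rowE.
Qed.

(** The pair (y', z') of conditional expectations of the adjoint. *)
Definition adj_mean (y : nat -> T -> 'cV[R]_n) k : T -> 'cV[R]_(n + n) :=
  mx_cond_exp P (past w k) (fun t => (noise_row n (w k t))^T *m y k.+1 t).

Lemma adj_meanE y k t : adj_mean y k t = col_mx (adj_y' w y k t) (adj_z' w y k t).
Proof.
apply/matrixP => i j; rewrite mxE; case: (split_ordP i) => l ->.
  rewrite col_mxEu mxE; congr (cond_exp _ _ _ t); apply/funext => t'.
  by rewrite noise_row_trE col_mxEu.
rewrite col_mxEd mxE; congr (cond_exp _ _ _ t); apply/funext => t'.
by rewrite noise_row_trE col_mxEd.
Qed.

Lemma adj_BDE y k t : adj_BD w E y k t = (stack_B k t)^T *m adj_mean y k t.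
Proof. by rewrite adj_meanE tr_col_mx mul_row_col. Qed.

Lemma adj_ACE y k t :
  (cA E k t)^T *m adj_y' w y k t + (cC E k t)^T *m adj_z' w y k t =
  (stack_A k t)^T *m adj_mean y k t.
Proof. by rewrite adj_meanE tr_col_mx mul_row_col. Qed.

Let sF k := past_sigma w k.
Let FT k := @past_measurable _ _ _ _ w k.
Let FS k := @pastS _ _ _ _ w k.
Let mw k := @past_noise _ _ _ _ w k.
Let ww k (kN : (k < N)%N) := (hw kN).2.

Lemma stack_A_bounded k : (k < N)%N -> bounded_mx P (past w k) (stack_A k).
Proof.
by case: hE => _ [bA bC _ _] _ _ _ kN; apply: bounded_col_mx; exact: LooFP kN.
Qed.

Lemma stack_B_bounded k : (k < N)%N -> bounded_mx P (past w k) (stack_B k).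
Proof.
by case: hE => _ [_ _ bB bD] _ _ _ kN; apply: bounded_col_mx; exact: LooFP kN.
Qed.

Lemma stack_b_square k : (k < N)%N -> square_mx P (past w k) (stack_b k).
Proof.
by case: hE => [[/L2FP sb /L2FP ss] _ _ _ _] kN; apply: square_col_mx;
  [exact: sb|exact: ss].
Qed.

Lemma cQ_bounded k : (k < N)%N -> bounded_mx P (past w k) (cQ E k).
Proof. by case: hE => _ _ _ _ [bQ _ _ _] kN; exact: LooFP kN. Qed.

Lemma cR_bounded k : (k < N)%N -> bounded_mx P (past w k) (cR E k).
Proof. by case: hE => _ _ _ _ [_ bR _ _] kN; exact: LooFP kN. Qed.

Lemma cG_bounded : bounded_mx P (past w N) (cG E).
Proof. by case: hE => _ _ _ [mG bG _] _; exact: ess_bounded_entry. Qed.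

Lemma transition_square k x u : (k < N)%N -> square_mx P (past w k) x ->
  square_mx P (past w k) u ->
  square_mx P (past w k) (fun t => transition k t (x t) (u t)).
Proof.
move=> kN sx su; apply: square_mxD => //; last exact: stack_b_square.
apply: square_mxD => //; apply: square_mxM => //.
  exact: stack_A_bounded.
exact: stack_B_bounded.
Qed.

Lemma flq_step_square k x u : (k < N)%N -> square_mx P (past w k) x ->
  square_mx P (past w k) u ->
  square_mx P (past w k.+1) (fun t => flq_step w E k t (x t) (u t)).
Proof.
move=> kN sx su; under eq_fun do rewrite flq_stepE.
apply: (square_noise (sF k) (sF k.+1) (@FS k) (@FT k.+1) (@mw k) (ww kN)).
exact: transition_square.
Qed.

(** Backward Riccati recursion, for the quadratic and the linear part of the
    adjoint as a function of the state; the index counts the steps back from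
    the final time. *)
Fixpoint riccati_back (j : nat) : (T -> 'M[R]_n) * (T -> 'cV[R]_n) :=
  if j is j'.+1 then
    let V := riccati_back j' in
    let k := (N - j'.+1)%N in
    let Pi := noise_quad_mean P (past w k) (w k) V.1 in
    let Phi := noise_lin_mean P (past w k) (w k) V.2 in
    (fun t => ric_P (Pi t) (stack_A k t) (stack_B k t) (cQ E k t) (cR E k t),
     fun t => ric_phi (Pi t) (stack_A k t) (stack_B k t) (stack_b k t) (Phi t)
                (cR E k t))
  else (cG E, fun=> 0).

Definition ric_mx k := (riccati_back (N - k)).1.
Definition ric_vec k := (riccati_back (N - k)).2.
Definition ric_Pi k := noise_quad_mean P (past w k) (w k) (ric_mx k.+1).
Definition ric_Phi k := noise_lin_mean P (past w k) (w k) (ric_vec k.+1).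
Definition gain_K k t := ric_K (ric_Pi k t) (stack_B k t) (cR E k t).
Definition gain_L k t :=
  ric_L (ric_Pi k t) (stack_A k t) (stack_B k t) (cR E k t).
Definition gain_l k t :=
  ric_l (ric_Pi k t) (stack_B k t) (stack_b k t) (ric_Phi k t) (cR E k t).

Lemma ric_mxE k t : (k < N)%N -> ric_mx k t =
  ric_P (ric_Pi k t) (stack_A k t) (stack_B k t) (cQ E k t) (cR E k t).
Proof.
move=> kN; have Nk : (N - k = (N - k.+1).+1)%N by rewrite subnSK.
by rewrite {1}/ric_mx Nk /= subnSK// subKn 1?ltnW.
Qed.

Lemma ric_vecE k t : (k < N)%N -> ric_vec k t =
  ric_phi (ric_Pi k t) (stack_A k t) (stack_B k t) (stack_b k t) (ric_Phi k t)
    (cR E k t).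
Proof.
move=> kN; have Nk : (N - k = (N - k.+1).+1)%N by rewrite subnSK.
by rewrite {1}/ric_vec Nk /= subnSK// subKn 1?ltnW.
Qed.

Lemma ric_mx_last : ric_mx N = cG E. Proof. by rewrite /ric_mx subnn. Qed.

Lemma ric_vec_last : ric_vec N = fun=> 0. Proof. by rewrite /ric_vec subnn. Qed.

Lemma cR_nonnegdef k t : (k < N)%N -> nonnegdef (cR E k t).
Proof.
move=> kN x; apply: le_trans (coercive_dot (hR t kN) x).
by rewrite mulr_ge0 ?dot_ge0// ltW.
Qed.

Lemma gain_K_coercive k t : (k < N)%N -> nonnegdef (ric_Pi k t) ->
  nonnegdef (gain_K k t - delta%:M).
Proof.
move=> kN Pi0 x; rewrite /gain_K /ric_K addrAC mulmxDl dotDl addr_ge0//.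
  exact: hR.
by rewrite -!mulmxA dot_mulmx trmxK.
Qed.

Let riccati_good k := [/\ bounded_mx P (past w k) (ric_mx k),
  square_mx P (past w k) (ric_vec k) & {ae P, forall t, nonnegdef (ric_mx k t)}].

Section step_facts.
Context k (kN : (k < N)%N) (good : riccati_good k.+1).

Let bPi : bounded_mx P (past w k) (ric_Pi k).
Proof.
have [bV _ _] := good.
exact: (noise_quad_mean_bounded (sF k) (sF k.+1) (@FS k) (@FT k.+1) (@mw k) (ww kN) bV).
Qed.

Let sPhi : square_mx P (past w k) (ric_Phi k).
Proof.
have [_ sV _] := good.
exact: (noise_lin_mean_square (sF k) (sF k.+1) (@FS k) (@FT k.+1) (@mw k) (ww kN) sV).
Qed.

Let Pi0 : {ae P, forall t, nonnegdef (ric_Pi k t)}.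
Proof.
have [bV _ V0] := good.
exact: (noise_quad_mean_nonnegdef (sF k) (sF k.+1) (@FS k) (@FT k.+1) (@mw k) (ww kN) bV V0).
Qed.

Let bK : bounded_mx P (past w k) (fun t => invmx (gain_K k t)).
Proof.
apply: (bounded_invmx (sF k) delta0); last first.
  by apply: filterS Pi0 => t; exact: gain_K_coercive.
apply: bounded_mxD => //; first exact: cR_bounded.
apply: bounded_mxM => //; last exact: stack_B_bounded.
apply: bounded_mxM => //; apply: bounded_mx_tr; exact: stack_B_bounded.
Qed.

Lemma step_gain_K_unit : {ae P, forall t, gain_K k t \in unitmx}.
Proof.
by apply: filterS Pi0 => t Pit; exact: coercive_unitmx delta0 (gain_K_coercive kN Pit).
Qed.

Lemma step_gain_L_bounded : bounded_mx P (past w k) (gain_L k).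
Proof.
apply: bounded_mxN => //; apply: bounded_mxM => //.
apply: bounded_mxM => //; last exact: stack_A_bounded.
apply: bounded_mxM => //; apply: bounded_mx_tr; exact: stack_B_bounded.
Qed.

Lemma step_gain_l_square : square_mx P (past w k) (gain_l k).
Proof.
apply: square_mxN => //; apply: square_mxM => //; apply: square_mxM => //.
  by apply: bounded_mx_tr; exact: stack_B_bounded.
apply: square_mxD => //; apply: square_mxM => //; exact: stack_b_square.
Qed.

Lemma step_riccati_good : riccati_good k.
Proof.
split.
- rewrite (_ : ric_mx k = fun t => ric_P (ric_Pi k t) (stack_A k t) (stack_B k t)
      (cQ E k t) (cR E k t)); last by apply/funext => t; exact: ric_mxE.
  apply: bounded_mxD => //; first exact: cQ_bounded.
  apply: bounded_mxM => //.
    by apply: bounded_mxM => //; apply: bounded_mx_tr; exact: stack_A_bounded.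
  apply: bounded_mxD => //; first exact: stack_A_bounded.
  by apply: bounded_mxM => //; [exact: stack_B_bounded|exact: step_gain_L_bounded].
- rewrite (_ : ric_vec k = fun t => ric_phi (ric_Pi k t) (stack_A k t) (stack_B k t)
      (stack_b k t) (ric_Phi k t) (cR E k t)); last by apply/funext => t; exact: ric_vecE.
  apply: square_mxM => //; first by apply: bounded_mx_tr; exact: stack_A_bounded.
  apply: square_mxD => //; apply: square_mxM => //.
  apply: square_mxD => //; last exact: stack_b_square.
  by apply: square_mxM => //; [exact: stack_B_bounded|exact: step_gain_l_square].
- apply: filterS2 Pi0 step_gain_K_unit => t Pit uK; rewrite ric_mxE//.
  by apply: ric_P_nonnegdef => //; [exact: hQ|exact: cR_nonnegdef].
Qed.

(** The next state is [I, w_k I] s with s the transition, which is known at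
    time k, so that cond_exp_affine applies. *)
Lemma step_adj_mean x u y : square_mx P (past w k) x -> square_mx P (past w k) u ->
  square_mx P (past w k.+1) (y k.+1) ->
  {ae P, forall t, y k.+1 t =
    ric_mx k.+1 t *m flq_step w E k t (x t) (u t) + ric_vec k.+1 t} ->
  {ae P, forall t, adj_mean y k t =
    ric_Pi k t *m transition k t (x t) (u t) + ric_Phi k t}.
Proof.
move=> sx su sy yx; have [bV sV V0] := good.
have H := cond_exp_affine (sF k) (sF k.+1) (@FS k) (@FT k.+1) (@mw k) (ww kN) bV sV
  (transition_square kN sx su).
have ymean : is_mx_cond_exp P (past w k)
    (fun t => (noise_row n (w k t))^T *m y k.+1 t) (adj_mean y k).
  apply: mx_cond_expP => //.
  exact: (noise_tr_L1 (sF k) (sF k.+1) (@FS k) (@FT k.+1) (@mw k) (ww kN)).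
apply: (is_mx_cond_exp_ae (sF k) (@FT k) ymean) => i j.
apply: (is_cond_exp_eql (@FT k) (H i j)).
  have [/measurable_int/measurable_EFinP mY _ _ _] := ymean i j.
  exact: mY.
by apply: filterS yx => t ->; rewrite flq_stepE.
Qed.

End step_facts.

Lemma riccatiP k : (k <= N)%N -> riccati_good k.
Proof.
move=> kN; rewrite -(subKn kN); elim: (N - k)%N (leq_subr k N) => [_|j IH jN].
  rewrite subn0 /riccati_good ric_mx_last ric_vec_last; split.
  - exact: cG_bounded.
  - exact: square_mx_cst.
  - exact: aeW.
have Nj : (N - j.+1 < N)%N by rewrite ltn_subrL (leq_trans _ jN).
by apply: step_riccati_good => //; rewrite subnSK//; apply: IH; exact: ltnW.
Qed.

Fixpoint closed_state xi (k : nat) t : 'cV[R]_n :=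
  if k is k'.+1 then
    flq_step w E k' t (closed_state xi k' t)
      (gain_L k' t *m closed_state xi k' t + gain_l k' t)
  else xi.

Definition closed_control xi k t : 'cV[R]_m :=
  gain_L k t *m closed_state xi k t + gain_l k t.

Definition closed_adjoint xi k t : 'cV[R]_n :=
  ric_mx k t *m closed_state xi k t + ric_vec k t.

Lemma flq_state_closed xi : flq_state w E xi (closed_control xi) = closed_state xi.
Proof.
apply/funext => k; elim: k => [//|k IH]; apply/funext => t /=.
by rewrite IH.
Qed.

Lemma gain_control_square k x : (k < N)%N -> square_mx P (past w k) x ->
  square_mx P (past w k) (fun t => gain_L k t *m x t + gain_l k t).
Proof.
move=> kN sx; have good := riccatiP kN; apply: square_mxD => //.
  by apply: square_mxM => //; exact: step_gain_L_bounded.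
exact: step_gain_l_square.
Qed.

Lemma closed_state_square xi k : (k <= N)%N ->
  square_mx P (past w k) (closed_state xi k).
Proof.
elim: k => [_|k IH kN]; first exact: square_mx_cst.
have sx := IH (ltnW kN).
exact: flq_step_square (gain_control_square kN sx).
Qed.

Lemma closed_control_square xi k : (k < N)%N ->
  square_mx P (past w k) (closed_control xi k).
Proof.
by move=> kN; apply: gain_control_square => //; apply: closed_state_square; exact: ltnW.
Qed.

Lemma closed_adjoint_square xi k : (k <= N)%N ->
  square_mx P (past w k) (closed_adjoint xi k).
Proof.
move=> kN; have [bV sV _] := riccatiP kN; apply: square_mxD => //.
by apply: square_mxM => //; exact: closed_state_square.
Qed.

(** An almost sure event has probability 1, hence is not empty. *)
Lemma ae_ex (Q : T -> Prop) : {ae P, forall t, Q t} -> exists t, Q t.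
Proof.
move=> [A [mA PA QA]]; apply: contrapT => nQ.
have AT : A = setT.
  by apply/seteqP; split=> // t _; apply: QA => Qt; apply: nQ; exists t.
by move: PA; rewrite AT probability_setT => /eqP; rewrite onee_eq0.
Qed.

Let ric_mx0_cst t t' : ric_mx 0 t = ric_mx 0 t'.
Proof.
apply: (@past0_mx_cst _ _ _ _ w) => i j.
by have [b _ _] := riccatiP (leq0n N); have [] := b i j.
Qed.

Let ric_vec0_cst t t' : ric_vec 0 t = ric_vec 0 t'.
Proof.
apply: (@past0_mx_cst _ _ _ _ w) => i j.
by have [_ b _] := riccatiP (leq0n N); have [] := b i j.
Qed.

Definition initial_state : 'cV[R]_n :=
  - (invmx (cM E + ric_mx 0 point) *m ric_vec 0 point).

(** The initial condition reads M x = - (P_0 x + phi_0) with constant P_0 and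
    phi_0, and M + P_0 is positive definite since P_0 is nonnegative
    definite. *)
Lemma initial_stateE x t :
  x = - (invmx (cM E) *m (ric_mx 0 t *m x + ric_vec 0 t)) <-> x = initial_state.
Proof.
have uM := posdef_unitmx hM.
have uMP : cM E + ric_mx 0 t \in unitmx.
  have [_ _ /ae_ex[t' P0]] := riccatiP (leq0n N).
  apply: posdef_unitmx => z z0; rewrite mulmxDl dotDl (ric_mx0_cst t t').
  by rewrite ltr_pwDl// hM.
rewrite /initial_state (ric_mx0_cst point t) (ric_vec0_cst point t).
split=> [xE|->].
  apply: (can_inj (mulKmx uMP)); rewrite mulmxN mulKVmx// mulmxDl {1}xE.
  by rewrite mulmxN mulKVmx// opprD addrAC addNr add0r.
apply: (can_inj (mulKmx uM)); rewrite !mulmxN mulKVmx//.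
set v := invmx (cM E + _) *m _; have vE : (cM E + ric_mx 0 t) *m v = ric_vec 0 t.
  by rewrite /v mulKVmx.
by rewrite -vE mulmxDl (addrC (_ *m v)) addKr.
Qed.

(** The closed-loop adjoint is affine in the state by construction, so that
    step_adj_mean turns each equation into an identity of the Riccati step. *)
Lemma closed_hamiltonian : hamiltonian_solution N w E
  (closed_state initial_state) (closed_adjoint initial_state)
  (closed_control initial_state).
Proof.
set xi := initial_state; split.
- by apply/L2FP => k kN; exact: closed_state_square.
- by apply/L2FP => k kN; exact: closed_adjoint_square.
have H : {ae P, forall t, forall k, (k < N)%N -> gain_K k t \in unitmx /\
    adj_mean (closed_adjoint xi) k t = ric_Pi k t *m transition k t
      (closed_state xi k t) (closed_control xi k t) + ric_Phi k t}.
  apply: ae_forall_lt => k kN; have good := riccatiP kN.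
  have sx := closed_state_square xi (ltnW kN).
  have sy := closed_adjoint_square xi kN.
  have := step_adj_mean kN good sx (closed_control_square xi kN) sy.
  move=> /(_ (aeW _ (fun t => erefl _))) mean.
  by apply: filterS2 (step_gain_K_unit kN good) mean => t.
apply: filterS H => t H; split => //.
- move=> k kN; have [uK mean] := H k kN.
  rewrite adj_ACE mean /transition /closed_adjoint ric_mxE// ric_vecE//.
  exact/esym/ric_adjoint.
- by apply/initial_stateE.
- by rewrite /closed_adjoint ric_mx_last ric_vec_last addr0.
- move=> k kN; have [uK mean] := H k kN.
  by rewrite adj_BDE mean; exact: ric_stationary.
Qed.

Section uniqueness.
Context (x y : nat -> T -> 'cV[R]_n) (u : nat -> T -> 'cV[R]_m).
Hypothesis H : hamiltonian_solution N w E x y u.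

Let sx k : (k <= N)%N -> square_mx P (past w k) (x k).
Proof. by move=> kN; case: H => /L2FP sx _ _; exact: sx. Qed.

Let sy k : (k <= N)%N -> square_mx P (past w k) (y k).
Proof. by move=> kN; case: H => _ /L2FP sy _; exact: sy. Qed.

(** The stationarity condition determines u almost surely in terms of y. This
    version of u is adapted and square-integrable. *)
Let v k t := - (invmx (cR E k t) *m adj_BD w E y k t).

Lemma adj_mean_square k : (k < N)%N -> square_mx P (past w k) (adj_mean y k).
Proof.
move=> kN; have syk := sy kN.
have L1y := noise_tr_L1 (sF k) (sF k.+1) (@FS k) (@FT k.+1) (@mw k) (ww kN) syk.
exact: (square_noise_cond_exp (sF k) (@FS k) (@FT k.+1) (ww kN)
  syk (mx_cond_expP (sF k) (@FT k) L1y)).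
Qed.

Lemma stationary_control_square k : (k < N)%N -> square_mx P (past w k) (v k).
Proof.
move=> kN; apply: square_mxN => //; apply: square_mxM => //.
  apply: (bounded_invmx (sF k) delta0); first exact: cR_bounded.
  by apply: aeW => t; exact: hR.
rewrite (_ : adj_BD w E y k = fun t => (stack_B k t)^T *m adj_mean y k t).
  apply: square_mxM => //; last exact: adj_mean_square.
  by apply: bounded_mx_tr; exact: stack_B_bounded.
by apply/funext => t; exact: adj_BDE.
Qed.

Lemma stationary_control :
  {ae P, forall t, forall k, (k < N)%N -> u k t = v k t}.
Proof.
case: H => _ _; apply: filterS => t [_ _ _ _ st] k kN.
have uR := coercive_unitmx delta0 (hR t kN).
apply: (can_inj (mulKmx uR)); rewrite /v mulmxN mulKVmx//.
by apply/eqP; rewrite -addr_eq0 addrC -st.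
Qed.

Let affine k := {ae P, forall t, y k t = ric_mx k t *m x k t + ric_vec k t}.

(** The affine form of the adjoint at time k + 1 makes the stationarity
    condition at time k linear in the control, which must be the Riccati
    feedback, and then propagates to time k. *)
Let affine_step k : (k < N)%N -> affine k.+1 ->
  affine k /\ {ae P, forall t, u k t = gain_L k t *m x k t + gain_l k t}.
Proof.
move=> kN aff; have good := riccatiP kN.
have sxk := sx (ltnW kN); have svk := stationary_control_square kN.
have mean := step_adj_mean kN good sxk svk (sy kN).
have {}mean : {ae P, forall t, adj_mean y k t =
    ric_Pi k t *m transition k t (x k t) (v k t) + ric_Phi k t}.
  apply: mean; case: H => _ _ Hae.
  apply: filterS3 aff Hae stationary_control => t -> [st _ _ _ _] uv.
  by rewrite st// uv.
have ctrl : {ae P, forall t, v k t = gain_L k t *m x k t + gain_l k t}.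
  case: H => _ _ Hae.
  apply: filterS2 mean
    (filterI (filterI (step_gain_K_unit kN good) Hae) stationary_control).
  move=> t mean [[uK [_ _ _ _ st]] uv]; apply: ric_feedback => //.
  by have := st k kN; rewrite adj_BDE mean uv.
split.
  case: H => _ _ Hae; apply: filterS3 mean Hae ctrl => t mean [_ ad _ _ _] vt.
  by rewrite ad// adj_ACE mean ric_mxE// ric_vecE//; exact: ric_adjoint.
by apply: filterS2 ctrl stationary_control => t <- ->.
Qed.

Lemma hamiltonian_affine k : (k <= N)%N -> affine k.
Proof.
move=> kN; rewrite -(subKn kN); elim: (N - k)%N (leq_subr k N) => [_|j IH jN].
  rewrite subn0; case: H => _ _; apply: filterS => t [_ _ _ yN _].
  by rewrite ric_mx_last ric_vec_last addr0.
have Nj : (N - j.+1 < N)%N by rewrite ltn_subrL (leq_trans _ jN).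
by have [] // := affine_step Nj; rewrite subnSK//; apply: IH; exact: ltnW.
Qed.

(** The affine form of the adjoint holds at all times, so the initial condition
    determines x_0 and the feedback determines the rest of the trajectory. *)
Lemma hamiltonian_unique : {ae P, forall t,
  (forall k, (k <= N)%N -> x k t = closed_state initial_state k t /\
    y k t = closed_adjoint initial_state k t) /\
  forall k, (k < N)%N -> u k t = closed_control initial_state k t}.
Proof.
have [_ _ Hae] := H.
have gains : {ae P, forall t, forall k, (k < N)%N ->
    u k t = gain_L k t *m x k t + gain_l k t}.
  apply: ae_forall_lt => k kN.
  by have [] := affine_step kN (hamiltonian_affine kN).
have aff : {ae P, forall t, forall k, (k < N.+1)%N ->
    y k t = ric_mx k t *m x k t + ric_vec k t}.
  by apply: ae_forall_lt => k kN; exact: hamiltonian_affine.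
apply: filterS3 Hae gains aff => t [st _ x0 _ _] ut yt.
have xt k : (k <= N)%N -> x k t = closed_state initial_state k t.
  elim: k => [_|k IH kN].
    by apply/(initial_stateE _ t); rewrite {1}x0 yt.
  by rewrite st// ut// IH// ltnW.
split=> k kN; first by rewrite yt// xt.
by rewrite ut// xt// ltnW.
Qed.

End uniqueness.
End hamiltonian.

(** * Optimality *)

Section optimality.
Context d (T : measurableType d) (R : realType) (P : probability T R).
Context (N : nat) (w : nat -> {RV P >-> R}) (hw : mart_diff N w).
Context (n m : nat) (E : flq_data T R n m) (hE : flq_setting N w E).
Hypothesis hM : posdef (cM E).
Hypothesis hG : forall t, nonnegdef (cG E t).
Hypothesis hQ : forall t k, (k < N)%N -> nonnegdef (cQ E k t).
Context (delta : R) (delta0 : 0 < delta).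
Hypothesis hR : forall t k, (k < N)%N -> nonnegdef (cR E k t - delta%:M).

Let sF k := past_sigma w k.
Let FT k := @past_measurable _ _ _ _ w k.
Let FS k := @pastS _ _ _ _ w k.
Let mw k := @past_noise _ _ _ _ w k.
Let ww k (kN : (k < N)%N) := (hw kN).2.

Implicit Types (x h : nat -> T -> 'cV[R]_n) (u g : nat -> T -> 'cV[R]_m).

Lemma flq_state_square xi u : admissible N w u -> forall k, (k <= N)%N ->
  square_mx P (past w k) (flq_state w E xi u k).
Proof.
move=> /L2FP su; elim=> [_|k IH kN]; first exact: square_mx_cst.
exact: (flq_step_square hw hE kN (IH (ltnW kN)) (su k kN)).
Qed.

(** The bilinear form whose diagonal has twice the cost as its mean. *)
Definition cost_form x u h g t : R :=
  dot (cM E *m x 0%N t) (h 0%N t) + dot (cG E t *m x N t) (h N t)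
  + \sum_(k < N) (dot (cQ E k t *m x k t) (h k t)
                  + dot (cR E k t *m u k t) (g k t)).

Let squares x u := (forall k, (k <= N)%N -> square_mx P (past w k) (x k)) /\
  (forall k, (k < N)%N -> square_mx P (past w k) (u k)).

Let running_L1 x u h g k : squares x u -> squares h g -> (k < N)%N ->
  P.-L1 (fun t => dot (cQ E k t *m x k t) (h k t)
                  + dot (cR E k t *m u k t) (g k t)).
Proof.
move=> [sx su] [sh sg] kN; apply: L1D; apply: (dot_L1 (sF k) (@FT k)).
- by apply: square_mxM => //; [exact: (cQ_bounded hE)|exact/sx/ltnW].
- exact/sh/ltnW.
- by apply: square_mxM => //; [exact: (cR_bounded hE)|exact: su].
- exact: sg.
Qed.

Lemma cost_form_L1 x u h g : squares x u -> squares h g ->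
  P.-L1 (cost_form x u h g).
Proof.
move=> sxu shg; have [sx su] := sxu; have [sh sg] := shg.
apply: L1D; last first.
  by apply: L1_sum => k; exact: running_L1.
apply: L1D.
  apply: (dot_L1 (sF 0) (@FT 0)); last exact: sh.
  by apply: square_mxM => //; [exact: bounded_mx_cst|exact: sx].
apply: (dot_L1 (sF N) (@FT N)); last exact: sh.
by apply: square_mxM => //; [exact: (cG_bounded hE)|exact: sx].
Qed.

Lemma dot_mulmx_sym p (A : 'M[R]_p) y z : symmetric_mx A ->
  dot (A *m y) z = dot (A *m z) y.
Proof. by move=> sA; rewrite dot_mulmx sA dotC. Qed.

Lemma cost_form_expand x u h g t :
  cost_form (fun k t => x k t + h k t) (fun k t => u k t + g k t)
    (fun k t => x k t + h k t) (fun k t => u k t + g k t) t =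
  cost_form x u x u t + 2 * cost_form x u h g t + cost_form h g h g t.
Proof.
case: hE => _ _ sM [_ _ sG] [_ _ sQ sR].
have sq p (A : 'M[R]_p) y z : symmetric_mx A -> dot (A *m (y + z)) (y + z) =
    dot (A *m y) y + 2 * dot (A *m y) z + dot (A *m z) z.
  move=> sA; rewrite mulmxDr dotDl !dotDr (dot_mulmx_sym z y sA); ring.
rewrite /cost_form !sq//.
rewrite (eq_bigr (fun k : 'I_N => (dot (cQ E k t *m x k t) (x k t)
      + dot (cR E k t *m u k t) (u k t))
    + 2 * (dot (cQ E k t *m x k t) (h k t) + dot (cR E k t *m u k t) (g k t))
    + (dot (cQ E k t *m h k t) (h k t) + dot (cR E k t *m g k t) (g k t)))).
  by rewrite !big_split/= -mulr_sumr big_split/=; ring.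
by move=> k _; rewrite !sq//; [ring|exact: sR|exact: sQ].
Qed.

Lemma cost_form_coercive x u t :
  dot (cM E *m x 0%N t) (x 0%N t) + delta * \sum_(k < N) dot (u k t) (u k t)
    <= cost_form x u x u t.
Proof.
rewrite /cost_form mulr_sumr lerD//; first by rewrite lerDl; exact: hG.
apply: ler_sum => k _; rewrite -[leLHS]add0r lerD//; first exact: hQ.
by apply: coercive_dot; exact: hR.
Qed.

Lemma dotM_ge0 y : 0 <= dot (cM E *m y) y.
Proof.
have [->|y0] := eqVneq y 0; last by rewrite ltW// hM.
by rewrite mulmx0 dot0l.
Qed.

Lemma cost_form_ge0 x u t : 0 <= cost_form x u x u t.
Proof.
apply: le_trans (cost_form_coercive x u t); rewrite addr_ge0 ?dotM_ge0//.
by rewrite mulr_ge0 ?(ltW delta0)//; apply: sumr_ge0 => k _; exact: dot_ge0.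
Qed.

Section duality.
Context (x y : nat -> T -> 'cV[R]_n) (u : nat -> T -> 'cV[R]_m).
Hypothesis sxu : squares x u.
Hypothesis H : hamiltonian_solution N w E x y u.
Context (h : nat -> T -> 'cV[R]_n) (g : nat -> T -> 'cV[R]_m).
Hypothesis shg : squares h g.
Hypothesis hS : forall k t, (k < N)%N -> h k.+1 t =
  noise_row n (w k t) *m (stack_A E k t *m h k t + stack_B E k t *m g k t).

Let sy k : (k <= N)%N -> square_mx P (past w k) (y k).
Proof. by move=> kN; case: H => _ /L2FP sy _; exact: sy. Qed.

Let increment k t := dot (y k.+1 t) (h k.+1 t) - dot (y k t) (h k t)
  + (dot (cQ E k t *m x k t) (h k t) + dot (cR E k t *m u k t) (g k t)).

Let increment_L1 k : (k < N)%N -> P.-L1 (increment k).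
Proof.
move=> kN; have [sh _] := shg; apply: L1D; last exact: running_L1.
apply: L1D; first by apply: (dot_L1 (sF k.+1) (@FT k.+1)); [exact: sy|exact: sh].
by apply: L1N; apply: (dot_L1 (sF k) (@FT k)); [exact/sy/ltnW|exact/sh/ltnW].
Qed.

(** As h_(k+1) = [I, w_k I] s with s known at time k, y_(k+1) may be replaced
    by its conditional means, and the adjoint and stationarity equations make
    the remaining terms cancel. *)
Let increment_mean k : (k < N)%N -> (\int[P]_t (increment k t)%:E = 0)%E.
Proof.
move=> kN; have [sh sg] := shg.
pose s t := stack_A E k t *m h k t + stack_B E k t *m g k t.
have ss : square_mx P (past w k) s.
  apply: square_mxD => //; apply: square_mxM => //.
  - exact: (stack_A_bounded hE).
  - exact/sh/ltnW.
  - exact: (stack_B_bounded hE).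
  - exact: sg.
have syk := sy kN.
have L1y := noise_tr_L1 (sF k) (sF k.+1) (@FS k) (@FT k.+1) (@mw k) (ww kN) syk.
have ymean : is_mx_cond_exp P (past w k) _ (adj_mean w y k) :=
  mx_cond_expP (sF k) (@FT k) L1y.
have [] := is_cond_exp_dot (sF k) (@FT k) ymean (Z := s).
- by move=> i j; have [] := ss i j.
- move=> i; under eq_fun do rewrite mxE mulr_suml.
  apply: L1_sum => l; under eq_fun do rewrite mxE mulrAC mulrC.
  apply: (squareM_L1 (sF k.+1) (@FT k.+1)); first exact: syk.
  apply: (noise_square (sF k) (sF k.+1) (@FS k) (@FT k.+1) (ww kN)).
  - exact: (noise_row_measurable (sF k.+1) (@mw k)).
  - by move=> t; exact: noise_row_le.
  - exact: ss.
move=> L1a L1b _ /(_ setT) ab.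
transitivity (\int[P]_t (dot ((noise_row n (w k t))^T *m y k.+1 t) (s t)
    - dot (adj_mean w y k t) (s t))%:E)%E.
  apply: ae_eq_integral => //.
  - exact: measurable_int (increment_L1 kN).
  - exact: measurable_int (L1D L1a (L1N L1b)).
  - case: H => _ _; apply: filterS => t [_ ad _ _ st] _.
    rewrite /increment hS// -/(s t) [in RHS]dot_mulmx trmxK; congr EFin.
    have Ru : cR E k t *m u k t = - ((stack_B E k t)^T *m adj_mean w y k t).
      by apply/eqP; rewrite -addr_eq0 addrC -adj_BDE -st.
    rewrite (ad k kN) adj_ACE Ru dotDl dotNl !(dot_mulmx _ (adj_mean w y k t)) !trmxK.
    by rewrite [in RHS]/s dotDr; ring.
under eq_integral do rewrite EFinB.
rewrite integralB_EFin// -ab ?subee//; first exact: integrable_fin_num.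
by have [s0 sC _] := sF k; have := sC _ s0; rewrite setD0.
Qed.

(** Since M x_0 = - y_0 and G x_N = y_N, the terms at both ends are the
    telescoping sum of <y_k, h_k>, and cost_form is a sum of increments of
    mean zero. *)
Lemma cost_form_stationary : (\int[P]_t (cost_form x u h g t)%:E = 0)%E.
Proof.
have sL1 : P.-L1 (fun t => \sum_(k < N) increment k t).
  by apply: L1_sum => k; exact: increment_L1.
transitivity (\int[P]_t (\sum_(k < N) increment k t)%:E)%E.
  apply: ae_eq_integral => //.
  - exact: measurable_int (cost_form_L1 sxu shg).
  - exact: measurable_int sL1.
  - case: H => _ _; apply: filterS => t [_ _ x0 yN _] _; congr EFin.
    have Mx0 : cM E *m x 0%N t = - y 0%N t.
      by rewrite x0 mulmxN mulKVmx// posdef_unitmx.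
    rewrite /increment big_split/= /cost_form; congr (_ + _).
    rewrite Mx0 -yN dotNl addrC.
    have := telescope_sumr (fun k => dot (y k t) (h k t)) (leq0n N).
    by rewrite big_mkord => ->.
under eq_integral do rewrite -sumEFin.
rewrite integral_sum//; last by move=> k; exact: increment_L1.
by apply: big1 => k _; exact: increment_mean.
Qed.

End duality.

Section minimizer.
Context (xi : 'cV[R]_n) (u : nat -> T -> 'cV[R]_m) (y : nat -> T -> 'cV[R]_n).
Hypothesis su : admissible N w u.
Hypothesis H : hamiltonian_solution N w E (flq_state w E xi u) y u.

Let x := flq_state w E xi u.
Let state_gap eta v k t := flq_state w E eta v k t - x k t.
Let control_gap v k t := (v : nat -> T -> 'cV[R]_m) k t - u k t.
Let gap eta v := cost_form (state_gap eta v) (control_gap v)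
  (state_gap eta v) (control_gap v).

Let squares_state eta v : admissible N w v -> squares (flq_state w E eta v) v.
Proof. by move=> sv; split; [exact: flq_state_square|exact/L2FP]. Qed.

Let squares_gap eta v : admissible N w v ->
  squares (state_gap eta v) (control_gap v).
Proof.
move=> sv; have [sX sV] := squares_state eta sv; have [sx su'] := squares_state xi su.
by split=> k kN; apply: square_mxB => //; [exact: sX|exact: sx|exact: sV|exact: su'].
Qed.

Let gap_L1 eta v : admissible N w v -> P.-L1 (gap eta v).
Proof. by move=> sv; apply: cost_form_L1; exact: squares_gap. Qed.

(** The cost is quadratic and the cross term vanishes by
    cost_form_stationary. *)
Lemma flq_cost_gap eta v : admissible N w v -> flq_cost N w E eta v =
  (flq_cost N w E xi u + (2^-1)%:E * \int[P]_t (gap eta v t)%:E)%E.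
Proof.
move=> sv; rewrite /flq_cost unlock.
have L1x := cost_form_L1 (squares_state xi su) (squares_state xi su).
have L1c := cost_form_L1 (squares_state xi su) (squares_gap eta sv).
have L1g := gap_L1 eta sv.
have stat : (\int[P]_t
    (cost_form x u (state_gap eta v) (control_gap v) t)%:E = 0)%E.
  apply: (cost_form_stationary (squares_state xi su) H (squares_gap eta sv)).
  move=> k t kN; rewrite /state_gap /control_gap /x /= !flq_stepE -mulmxBr.
  congr (_ *m _); rewrite /transition !mulmxBr.
  by rewrite opprD addrACA subrr addr0 opprD addrACA.
rewrite -muleDr//; last first.
  by apply: fin_num_adde_defl; apply: integrable_fin_num.
congr (_ * _)%E.
transitivity (\int[P]_t (cost_form x u x u t +
    2 * cost_form x u (state_gap eta v) (control_gap v) t + gap eta v t)%:E)%E.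
  apply: eq_integral => t _; rewrite -cost_form_expand /cost_form /state_gap /control_gap.
  by congr (EFin (_ + _ + _)); rewrite ?subrKC//; apply: eq_bigr => k _; rewrite !subrKC.
under eq_integral do rewrite EFinD.
have L1c2 := L1Z 2 L1c.
rewrite integralD_EFin//; last exact: (L1D L1x L1c2).
congr (_ + _)%E; under eq_integral do rewrite /= EFinD.
rewrite integralD_EFin//; under [X in (_ + X)%E]eq_integral do rewrite /= EFinM.
by rewrite integralZl// stat mule0 adde0.
Qed.

Lemma solution_flq_optimal : flq_optimal N w E xi u.
Proof.
split=> //; apply/eqP; rewrite eq_le; apply/andP; split; last first.
  by apply: ereal_inf_lbound; exists xi => //; exists u.
apply: le_ereal_inf_tmp => _ [eta _ [v sv <-]]; rewrite (flq_cost_gap eta sv).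
rewrite leeDl// mule_ge0//; apply: integral_ge0 => t _.
by rewrite lee_fin; exact: cost_form_ge0.
Qed.

(** For an optimal pair the gap has mean zero; being nonnegative it vanishes
    almost surely, and it dominates <M h_0, h_0> + delta sum_k |g_k|^2. *)
Lemma flq_optimal_unique eta v : flq_optimal N w E eta v ->
  eta = xi /\ {ae P, forall t, forall k, (k < N)%N -> v k t = u k t}.
Proof.
move=> [sv Jv]; have [_ Ju] := solution_flq_optimal.
have gap0 : (\int[P]_t (gap eta v t)%:E = 0)%E.
  have L1x := cost_form_L1 (squares_state xi su) (squares_state xi su).
  have L1g := gap_L1 eta sv.
  have := flq_cost_gap eta sv; rewrite {1}Jv -Ju.
  have Jfin : flq_cost N w E xi u \is a fin_num.
    by rewrite /flq_cost unlock fin_numM//; apply: integrable_fin_num.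
  have Gfin : (\int[P]_t (gap eta v t)%:E)%E \is a fin_num.
    exact: integrable_fin_num.
  rewrite -(fineK Jfin) -(fineK Gfin) -EFinM -EFinD => -[] /eqP.
  rewrite -subr_eq0 opprD addNKr oppr_eq0 mulf_eq0 invr_eq0 pnatr_eq0 /=.
  by move=> /eqP ->.
have gap_ae : {ae P, forall t, gap eta v t = 0}.
  have mg : measurable_fun setT (EFin \o gap eta v).
    exact: measurable_int (gap_L1 eta sv).
  have /ae_eq_integral_abs := mg; move=> /(_ P measurableT)[+ _].
  under eq_integral do rewrite /= ger0_norm ?cost_form_ge0//.
  by move=> /(_ gap0); apply: filterS => t /(_ I) [].
have zero t : gap eta v t = 0 -> eta = xi /\ forall k, (k < N)%N -> v k t = u k t.
  move=> g0; have := cost_form_coercive (state_gap eta v) (control_gap v) t.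
  rewrite -/(gap eta v t) g0 => le0.
  have M0 := dotM_ge0 (state_gap eta v 0 t).
  have S0 : 0 <= \sum_(k < N) dot (control_gap v k t) (control_gap v k t).
    by apply: sumr_ge0 => k _; exact: dot_ge0.
  have dS0 := mulr_ge0 (ltW delta0) S0.
  split.
    apply/eqP; rewrite -subr_eq0; apply: contraT => /hM Mpos.
    by move: le0; rewrite leNgt ltr_pwDl.
  move=> k kN; apply/eqP; rewrite -subr_eq0; apply/eqP/dot_eq0/eqP.
  have : delta * \sum_(k < N) dot (control_gap v k t) (control_gap v k t) == 0.
    by rewrite eq_le dS0 andbT (le_trans _ le0)// lerDr.
  rewrite mulf_eq0 gt_eqF//= psumr_eq0 => [/allP/(_ (Ordinal kN))|? _].
    by apply; exact: mem_index_enum.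
  exact: dot_ge0.
split; first by have [t /zero[]] := ae_ex gap_ae.
by apply: filterS gap_ae => t /zero[].
Qed.

End minimizer.
End optimality.

Theorem theorem4p1 (d : measure_display) (T : measurableType d) (R : realType)
    (P : probability T R) (hP : measure_is_complete P)
    (N : nat) (hN : (0 < N)%N)
    (w : nat -> {RV P >-> R}) (hw : mart_diff N w)
    (n m : nat) (E : flq_data T R n m) (hE : flq_setting N w E)
    (hM : posdef (cM E))
    (hG : forall omega, nonnegdef (cG E omega))
    (hQ : forall omega k, (k < N)%N -> nonnegdef (cQ E k omega))
    (hR : exists delta : R, 0 < delta /\
       forall omega k, (k < N)%N -> nonnegdef (cR E k omega - delta%:M)) :
  exists (x y : nat -> T -> 'cV[R]_n) (u : nat -> T -> 'cV[R]_m)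
         (xi : 'cV[R]_n),
    [/\ hamiltonian_solution N w E x y u,
        forall x2 y2 u2, hamiltonian_solution N w E x2 y2 u2 ->
          {ae P, forall omega, forall k, (k <= N)%N ->
             x2 k omega = x k omega /\ y2 k omega = y k omega},
        forall omega, xi = - (invmx (cM E) *m y 0%N omega),
        {ae P, forall omega, forall k, (k < N)%N ->
           u k omega = - (invmx (cR E k omega) *m adj_BD w E y k omega)}
      & flq_optimal N w E xi u /\
        forall xi2 u2, flq_optimal N w E xi2 u2 ->
          xi2 = xi /\
          {ae P, forall omega, forall k, (k < N)%N ->
             u2 k omega = u k omega}].
Proof.
have [delta [delta0 Rdelta]] := hR.
have sol := closed_hamiltonian hw hE hM hG hQ delta0 Rdelta.
have adm : admissible N w (closed_control N w E (initial_state N w E)).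
  apply/L2FP => k kN.
  exact: (closed_control_square hw hE hG hQ delta0 Rdelta).
have sol' := sol; rewrite -flq_state_closed in sol'.
exists (closed_state N w E (initial_state N w E)).
exists (closed_adjoint N w E (initial_state N w E)).
exists (closed_control N w E (initial_state N w E)), (initial_state N w E).
split => //.
- move=> x2 y2 u2 sol2.
  have := hamiltonian_unique hw hE hM hG hQ delta0 Rdelta sol2.
  by apply: filterS => t [].
- by move=> t; apply/(initial_stateE hw hE hM hG hQ delta0 Rdelta).
- exact: (stationary_control delta0 Rdelta sol).
- split; first exact: (solution_flq_optimal hw hE hM hG hQ delta0 Rdelta adm sol').
  move=> xi2 u2.
  exact: (flq_optimal_unique hw hE hM hG hQ delta0 Rdelta adm sol').
Qed.
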